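(* For an oriented link $L$ in $\mathbb{R}^3$ and any plane diagram $D$ of $L$, $$K(L)=(1-q^2)\sum_{i\in\mathbb{Z}}(-1)^i\,\widehat{\chi}(H^i(D)),$$ where $K(L)$ is the scaled Kauffman bracket of $L$ and $\widehat\chi$ is the graded Euler characteristic (an equality of Laurent series in $q$).
   Context: Let $R=\mathbb{Z}[c]$, graded by $\deg(1)=0$, $\deg(c)=2$. All tensor products are over $R$ unless indicated. For a graded $R$-module $N$ let $N\{n\}$ be the graded module with $N\{n\}_i=N_{i+n}$. For a complex $N$ let $N[n]^i=N^{i+n}$ with differential $(-1)^n d^{i+n}$. For a finitely generated graded $R$-module $M=\bigoplus_j M_j$ put $\widehat\chi(M)=\sum_{j\in\mathbb Z}\dim_{\mathbb Q}(M_j\otimes_{\mathbb Z}\mathbb Q)\,q^j$, a Laurent series in $q$. Let $A$ be the free graded $R$-module with basis $\mathbf{1},X$, $\deg(\mathbf 1)=1$, $\deg(X)=-1$; tensor powers carry the additive grading. Define $R$-linear maps $m:A\otimes A\to A$, a commutative product with unit $\mathbf 1$ and $X^2=0$, and $\Delta:A\to A\otimes A$, $\Delta(\mathbf 1)=\mathbf 1\otimes X+X\otimes\mathbf 1+cX\otimes X$, $\Delta(X)=X\otimes X$. Both have degree $-1$. A plane diagram $D$ is a generic plane projection (finitely many transverse double points, with over/under information). Each double point has two resolutions: the $0$-resolution joins the two regions swept out by rotating the overstrand counterclockwise until it meets the understrand; the $1$-resolution is the other smoothing. For an oriented diagram, $y(D)$ is the number of positive crossings (those whose $0$-resolution is compatible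 with the orientation) and $x(D)$ is the number of negative crossings (those whose $1$-resolution is compatible with the orientation). Scaled Kauffman bracket: $\langle D\rangle\in\mathbb Z[q,q^{-1}]$ is determined by: a simple closed loop evaluates to $q+q^{-1}$; $\langle D_1\rangle=\langle D_2\rangle-q\langle D_3\rangle$ whenever $D_2$, $D_3$ are obtained from $D_1$ by the $0$-resolution, respectively $1$-resolution, of one double point; and $\langle D_1\sqcup D_2\rangle=\langle D_1\rangle\langle D_2\rangle$. Put $K(D)=(-1)^{x(D)}q^{y(D)-2x(D)}\langle D\rangle$; it depends only on $L$ and is denoted $K(L)$. Let $\mathcal I$ be the set of double points of $D$. For $\mathcal L\subset\mathcal I$ let $D(\mathcal L)$ be the collection of disjoint simple closed curves obtained by taking the $1$-resolution at points of $\mathcal L$ and the $0$-resolution at the other points. Put $V_D(\mathcal L)=A^{\otimes k}\{-|\mathcal L|\}$, with tensor factors indexed by the $k$ circles of $D(\mathcal L)$. For $a\in\mathcal I\setminus\mathcal L$, passing from $D(\mathcal L)$ to $D(\mathcal L\cup\{a\})$ either merges two circles or splits one circle into two; let $\xi_a(\mathcal L):V_D(\mathcal L)\to V_D(\mathcal L\cup\{a\})$ be $m$, respectively $\Delta$, on the corresponding factors and the identity on the other factors (a grading-preserving map). Fix a total order on $\mathcal I$ (different orders give isomorphic complexes). Let $\overline C(D)$ be the complex of graded $R$-modules with $\overline C^i(D)=\bigoplus_{|\mathcal L|=i}V_D(\mathcal L)$ and differential $d(v)=\sum_{a\in\mathcal I\setminus\mathcal L}(-1)^{\#\{b\in\mathcal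 L:\,b>a\}}\xi_a(\mathcal L)(v)$ for $v\in V_D(\mathcal L)$. Put $C(D)=\overline C(D)[x(D)]\{2x(D)-y(D)\}$, and let $H^i(D)$ be the $i$-th cohomology group of $C(D)$, a finitely generated graded $R$-module. *)

(* Defs.v *)
From HB Require Import structures.
From mathcomp Require Import all_boot all_order all_algebra.
From mathcomp Require Import generic_quotient ring_quotient.
From mathcomp Require Import boolp classical_sets functions cardinality fsbigop.

Set Implicit Arguments.
Unset Strict Implicit.
Unset Printing Implicit Defensive.

Import Order.TTheory GRing.Theory Num.Theory.
Local Open Scope ring_scope.

(* A link diagram is encoded as a combinatorial map.  Its vertices are the double
   points (valency 4) and, possibly, auxiliary points on the curves (valency 2),
   which carry no information but make room for closed curves without double
   point.  A dart is an edge-end at a vertex: arc p is the other end of its edge,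
   rot p the next dart counterclockwise at its vertex, and over p tells whether
   it belongs to the overstrand (relevant at double points only). *)
Record diagram := Diagram {
  dart : finType;
  arc : dart -> dart;
  rot : dart -> dart;
  over : pred dart;
  arcK : involutive arc;
  arc_neq : forall p, arc p != p;
  rot4 : forall p, rot (rot (rot (rot p))) = p;
  rot_neq : forall p, rot p != p;
  over_alt : forall p, rot (rot p) != p -> over (rot p) = ~~ over p
}.
Arguments arc {d}.
Arguments rot {d}.
Arguments over {d}.

Section Diagrams.
Context (D : diagram).

Definition vertex (p : dart D) : {set dart D} :=
  [set p; rot p; rot (rot p); rot (rot (rot p))].

Definition is_double (p : dart D) : bool := rot (rot p) != p.

Definition double_points : {set {set dart D}} :=
  [set vertex p | p in [pred p | is_double p]].

(* Genus 0: #vertices + #faces = #edges + 2 #components, the faces being the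
   orbits of rot \o arc.  The relative position of distinct components in the
   plane is not recorded: no notion below depends on it. *)
Definition planar : Prop :=
  (fcard (@rot D) (dart D) + fcard (fun p : dart D => rot (arc p)) (dart D)
   = fcard (@arc D) (dart D)
     + (n_comp [rel p p' : dart D | (p' == arc p) || (p' == rot p)] (dart D)).*2)%N.

(* The dart joined to p by the b-resolution (b = false: 0, b = true: 1) of its
   vertex.  The corners swept by rotating the overstrand counterclockwise are
   those between an over dart p and rot p; the 0-resolution merges them, so it
   joins p to rot^-1 p = rot^3 p.  At a vertex of valency 2 this is rot p. *)
Definition smooth (b : bool) (p : dart D) : dart D :=
  if over p == b then rot p else rot (rot (rot p)).

(* The system of curves D(L): each curve is given by its set of darts. *)
Definition smoothing (L : {set {set dart D}}) (p : dart D) : dart D :=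
  smooth (vertex p \in L) p.

Definition circles (L : {set {set dart D}}) : {set {set dart D}} :=
  let e := [rel p p' | (p' == arc p) || (p' == smoothing L p)] in
  [set [set p' | connect e p p'] | p in dart D].

Definition opposite (p : dart D) : dart D :=
  if is_double p then rot (rot p) else rot p.

(* o p = true when the orientation leaves the vertex of p along p. *)
Definition orientation (o : pred (dart D)) : Prop :=
  forall p, o (arc p) = ~~ o p /\ o (opposite p) = ~~ o p.

(* The double points whose b-resolution is compatible with the orientation. *)
Definition compatible (o : pred (dart D)) (b : bool) : {set {set dart D}} :=
  [set a in double_points | [forall p in a, o (smooth b p) == ~~ o p]].

Definition ycross (o : pred (dart D)) : nat := #|compatible o false|.
Definition xcross (o : pred (dart D)) : nat := #|compatible o true|.

End Diagrams.

Arguments double_points : clear implicits.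

(* The b-resolution of the vertex of p. *)
Section Resolve.
Context (D : diagram) (p : dart D) (b : bool).

Definition res_rot (x : dart D) : dart D :=
  if x \in vertex p then smooth b x else rot x.

Lemma vertex_rot (x : dart D) : (rot x \in vertex p) = (x \in vertex p).
Proof.
have rot_inj : injective (@rot D).
  by apply: (can_inj (g := fun x => rot (rot (rot x)))) => y; rewrite rot4.
rewrite !inE -{1}(rot4 p) !(inj_eq rot_inj).
by rewrite -!orbA orbC -!orbA.
Qed.

Lemma smoothK : involutive (smooth (D := D) b).
Proof.
move=> x; rewrite /smooth.
have [x2|x2] := eqVneq (rot (rot x)) x.
  by rewrite !x2 !if_same !x2 if_same.
have oR : over (rot x) = ~~ over x by rewrite over_alt.
have oR3 : over (rot (rot (rot x))) = ~~ over x.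
  have h : rot (rot (rot (rot (rot x)))) != rot (rot (rot x)).
    by rewrite rot4; apply/eqP => /(congr1 rot); rewrite rot4; apply/eqP.
  by have := over_alt h; rewrite rot4 => ->; rewrite negbK.
have [e|ne] := eqVneq (over x) b.
  by rewrite oR e; case: (b) => /=; rewrite rot4.
by rewrite oR3; move: ne; case: (over x); case: (b) => //= _; rewrite rot4.
Qed.

Lemma smooth_neq (x : dart D) : smooth b x != x.
Proof.
rewrite /smooth; case: ifP => _; first exact: rot_neq.
by apply/eqP => /(congr1 rot); rewrite rot4 => /eqP; rewrite eq_sym (negPf (rot_neq x)).
Qed.

Lemma vertex_smooth (x : dart D) : (smooth b x \in vertex p) = (x \in vertex p).
Proof. by rewrite /smooth; case: ifP => _; rewrite !vertex_rot. Qed.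

Lemma res_rot4 (x : dart D) : res_rot (res_rot (res_rot (res_rot x))) = x.
Proof.
rewrite /res_rot; case: (boolP (x \in vertex p)) => xp.
  by rewrite !(vertex_smooth, xp, smoothK).
by rewrite !(vertex_rot, negPf xp, rot4).
Qed.

Lemma res_rot_neq (x : dart D) : res_rot x != x.
Proof. by rewrite /res_rot; case: ifP; rewrite ?smooth_neq ?rot_neq. Qed.

Lemma res_over_alt (x : dart D) :
  res_rot (res_rot x) != x -> over (res_rot x) = ~~ over x.
Proof.
rewrite /res_rot; case: (boolP (x \in vertex p)) => xp.
  by rewrite vertex_smooth xp smoothK eqxx.
by rewrite vertex_rot (negPf xp) => /over_alt.
Qed.

Definition resolve : diagram :=
  Diagram (@arcK D) (@arc_neq D) res_rot4 res_rot_neq res_over_alt.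

End Resolve.

Section DisjointUnion.
Context (D1 D2 : diagram).
Let T : finType := (dart D1 + dart D2)%type.

Definition du_arc (p : T) : T :=
  match p with inl p1 => inl (arc p1) | inr p2 => inr (arc p2) end.
Definition du_rot (p : T) : T :=
  match p with inl p1 => inl (rot p1) | inr p2 => inr (rot p2) end.
Definition du_over (p : T) : bool :=
  match p with inl p1 => over p1 | inr p2 => over p2 end.

Lemma du_arcK : involutive du_arc.
Proof. by case=> p /=; rewrite arcK. Qed.
Lemma du_arc_neq p : du_arc p != p.
Proof. by case: p => p; apply: (arc_neq p). Qed.
Lemma du_rot4 p : du_rot (du_rot (du_rot (du_rot p))) = p.
Proof. by case: p => p /=; rewrite rot4. Qed.
Lemma du_rot_neq p : du_rot p != p.
Proof. by case: p => p; apply: (rot_neq p). Qed.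
Lemma du_over_alt p : du_rot (du_rot p) != p -> du_over (du_rot p) = ~~ du_over p.
Proof. by case: p => p; apply: (@over_alt _ p). Qed.

Definition disjoint_union : diagram :=
  Diagram du_arcK du_arc_neq du_rot4 du_rot_neq du_over_alt.

End DisjointUnion.

Definition diagram_iso (D D' : diagram) : Prop :=
  exists f : dart D -> dart D',
    [/\ bijective f,
        forall p, f (arc p) = arc (f p),
        forall p, f (rot p) = rot (f p) &
        forall p, is_double p -> over (f p) = over p].

(* Laurent series in q, as coefficient functions: f j is the coefficient of q^j. *)
Definition laurent := int -> int.

Definition qpow (n : int) : laurent := fun j => (j == n)%:R.

(* Used only when f or g has finite support, so that the sum is finite. *)
Definition lmul (f g : laurent) : laurent :=
  fun j => \sum_(k \in [set: int]) f k * g (j - k).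

Definition laurent_polynomial (f : laurent) : Prop :=
  finite_set [set j | f j != 0].

Definition loop_value : laurent := qpow 1 \+ qpow (-1).

(* bracket_iso says that br does not depend on the names of the darts; in
   bracket_loop the curve may carry any number of auxiliary points. *)
Record kauffman_bracket (br : diagram -> laurent) : Prop := KauffmanBracket {
  bracket_poly : forall D, planar D -> laurent_polynomial (br D);
  bracket_iso : forall D D', planar D -> planar D' ->
    diagram_iso D D' -> br D = br D';
  bracket_loop : forall D, planar D -> double_points D = finset.set0 ->
    #|circles (D := D) finset.set0| = 1%N -> br D = loop_value;
  bracket_skein : forall (D : diagram) (p : dart D), planar D ->
    is_double p ->
    br D = br (resolve p false) \- lmul (qpow 1) (br (resolve p true));
  bracket_union : forall D1 D2, planar D1 -> planar D2 ->
    br (disjoint_union D1 D2) = lmul (br D1) (br D2)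
}.

Definition scaled_bracket (br : diagram -> laurent) (D : diagram)
    (o : pred (dart D)) : laurent :=
  lmul (fun j => (-1) ^+ xcross o
                 * qpow ((ycross o)%:Z - (xcross o)%:Z *+ 2) j) (br D).

(* The ground ring Z[c], with c = 'X of degree 2. *)
Local Notation Rc := {poly int}.

(* A module with its homogeneous parts.  The direct sum decomposition and
   c M_j <= M_(j+2) are not recorded: chi_hat only involves the pieces. *)
Record gmodule := GModule {
  carrier :> lmodType Rc;
  piece : int -> pred carrier;
  piece_closed : forall j, zmod_closed (piece j)
}.

Definition gshift (M : gmodule) (n : int) : gmodule :=
  GModule (fun j => @piece_closed M (j + n)).

Section Piece.
Context (M : gmodule) (j : int).
HB.instance Definition _ :=
  GRing.isZmodClosed.Build M (@piece M j) (@piece_closed M j).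
Definition homogeneous := {v : M | @piece M j v}.
HB.instance Definition _ := SubType.on homogeneous.
HB.instance Definition _ := Choice.on homogeneous.
HB.instance Definition _ := [SubChoice_isSubZmodule of homogeneous by <:].
End Piece.

(* i exhibits the Q-vector space V as the extension of scalars of the abelian
   group M along Z -> Q, i.e. V is the tensor product of M and Q over Z. *)
Definition is_tensorQ (M : zmodType) (V : vectType rat)
    (i : {additive M -> V}) : Prop :=
  forall (W : lmodType rat) (f : {additive M -> W}),
    exists2 g : {linear V -> W}, (forall x, g (i x) = f x) &
      forall h : {linear V -> W}, (forall x, h (i x) = f x) -> h =1 g.

(* The dimension over Q of the tensor product of M and Q over Z (0 if it is
   infinite). *)
Definition dimQ (M : zmodType) : nat :=
  xget 0%N [set n | exists (V : vectType rat) (i : {additive M -> V}),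
                      is_tensorQ i /\ \dim {:V} = n].

Definition chi_hat (M : gmodule) : laurent :=
  fun j => (dimQ (homogeneous M j))%:Z.

(* diff i k is meant for k = i + 1; indexing by both degrees avoids casts in the
   shifted complexes. *)
Record gcomplex := GComplex {
  cochain : int -> gmodule;
  diff : forall i k : int, {linear cochain i -> cochain k}
}.

Definition cshift (C : gcomplex) (n : int) : gcomplex :=
  GComplex (cochain := fun i => cochain C (i + n))
    (fun i k => GRing.scale ((-1) ^ n : Rc) \o @diff C (i + n) (k + n)).

Definition cgshift (C : gcomplex) (n : int) : gcomplex :=
  GComplex (cochain := fun i => gshift (cochain C i) n) (@diff C).

(* Cocycles modulo coboundaries, as an R-module; coboundaries that are not
   cocycles (there are none when g \o f = 0) are disregarded. *)
Section Subquotient.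
Context (U V W : lmodType Rc) (f : {linear U -> V}) (g : {linear V -> W}).

Definition is_cocycle : pred V := fun v => g v == 0.

Lemma is_cocycle_closed : submod_closed is_cocycle.
Proof.
split=> [|a u v]; first by rewrite unfold_in /is_cocycle linear0.
by rewrite !unfold_in /is_cocycle linearP => /eqP-> /eqP->; rewrite scaler0 addr0.
Qed.
HB.instance Definition _ :=
  GRing.isSubmodClosed.Build Rc V is_cocycle is_cocycle_closed.

Definition cocycle := {v : V | is_cocycle v}.
HB.instance Definition _ := SubType.on cocycle.
HB.instance Definition _ := Choice.on cocycle.
HB.instance Definition _ := [SubChoice_isSubLmodule of cocycle by <:].

Definition is_coboundary : pred cocycle := fun z => `[< exists u, f u = val z >].

Lemma is_coboundary_closed : submod_closed is_coboundary.
Proof.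
split=> [|a u v]; rewrite !unfold_in.
  by apply/asboolP; exists 0; rewrite !linear0.
move=> /asboolP[u' eu] /asboolP[v' ev]; apply/asboolP.
by exists (a *: u' + v'); rewrite !linearP eu ev.
Qed.
HB.instance Definition _ :=
  GRing.isSubmodClosed.Build Rc cocycle is_coboundary is_coboundary_closed.

Definition cohomology_module :=
  Quotient.quot (GRing.ZmodClosed.clone cocycle is_coboundary _).
HB.instance Definition _ := GRing.Zmodule.on cohomology_module.

Definition coh_class : {additive cocycle -> cohomology_module} :=
  (\pi_cohomology_module)%qT.

Definition coh_scale (a : Rc) (x : cohomology_module) : cohomology_module :=
  coh_class (a *: repr x).

Lemma coh_classP (u v : cocycle) :
  coh_class u = coh_class v <-> u - v \in is_coboundary.
Proof. by rewrite [_ \in _]Quotient.idealrBE; split=> /eqP. Qed.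

Lemma coh_classK (x : cohomology_module) : coh_class (repr x) = x.
Proof. exact: reprK. Qed.

Lemma coh_scaleE a u : coh_scale a (coh_class u) = coh_class (a *: u).
Proof.
apply/coh_classP; rewrite -scalerBr rpredZ //.
by apply/coh_classP; rewrite coh_classK.
Qed.

Lemma coh_scaleA a b x : coh_scale a (coh_scale b x) = coh_scale (a * b) x.
Proof. by rewrite -[x]coh_classK !coh_scaleE scalerA. Qed.
Lemma coh_scale1 : left_id 1 coh_scale.
Proof. by move=> x; rewrite -[x]coh_classK !coh_scaleE scale1r. Qed.
Lemma coh_scaleDr : right_distributive coh_scale +%R.
Proof.
move=> a x y; rewrite -[x]coh_classK -[y]coh_classK -raddfD !coh_scaleE.
by rewrite scalerDr raddfD.
Qed.
Lemma coh_scaleDl x : {morph coh_scale^~ x : a b / a + b}.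
Proof. by move=> a b; rewrite -[x]coh_classK !coh_scaleE scalerDl raddfD. Qed.

HB.instance Definition _ := GRing.Zmodule_isLmodule.Build Rc cohomology_module
  coh_scaleA coh_scale1 coh_scaleDr coh_scaleDl.

End Subquotient.

(* The degree j part of the cohomology consists of the classes of the cocycles
   of degree j. *)
Section Cohomology.
Context (C : gcomplex) (i : int).
Let f := @diff C (i - 1) i.
Let g := @diff C i (i + 1).

Definition coh_piece (j : int) : pred (cohomology_module f g) :=
  fun x => `[< exists2 z : cocycle g, piece j (val z) & coh_class f g z = x >].

Lemma coh_piece_closed j : zmod_closed (coh_piece j).
Proof.
have [h0 hB] := @piece_closed (cochain C i) j.
split=> [|x y]; rewrite !unfold_in.
  by apply/asboolP; exists 0; rewrite ?raddf0.
move=> /asboolP[u uj <-] /asboolP[v vj <-]; apply/asboolP.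
by exists (u - v); rewrite ?raddfB //; apply: hB.
Qed.

Definition cohomology : gmodule := GModule coh_piece_closed.

End Cohomology.

(* The basis 1, X of A is encoded as false, true.  m_coef x y z is the
   coefficient of z in m(x (x) y) and Delta_coef x y z is that of y (x) z in
   Delta(x). *)
Definition label_deg (x : bool) : int := if x then -1 else 1.

Definition m_coef (x y z : bool) : Rc :=
  if x && y then 0 else (z == x || y)%:R.

Definition Delta_coef (x y z : bool) : Rc :=
  match x, y, z with
  | false, false, true | false, true, false => 1
  | false, true, true => 'X
  | true, true, true => 1
  | _, _, _ => 0
  end.

Section Khovanov.
Context (D : diagram).
Local Notation pt := {set dart D}.

(* The tensor power of A over the circles of D(L) is free over R on the
   labellings of these circles by 1 or X.  A labelling is given by the set S of
   the circles labelled X; C \in S is the label of C.  The basis of Cbar^i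
   consists of the pairs (L, S) with |L| = i. *)
Definition generator (i : int) :=
  {s : {set pt} * {set pt} | [&& s.1 \subset double_points D,
                                #|s.1|%:Z == i & s.2 \subset circles s.1]}.

(* Degree in V_D(L); the summand |L| comes from the shift {-|L|}. *)
Definition gen_deg (s : {set pt} * {set pt}) : int :=
  \sum_(C in circles s.1) label_deg (C \in s.2) + #|s.1|%:Z.

Definition cube (i : int) : lmodType Rc := {ffun generator i -> Rc^o}.

(* v is homogeneous of degree j: c^n times the generator s has degree
   2n + gen_deg s. *)
Definition cube_piece (i j : int) : pred (cube i) :=
  fun v => `[< forall (s : generator i) (n : nat),
                 (v s : Rc)`_n != 0 -> n%:Z *+ 2 + gen_deg (val s) = j >].

Lemma cube_piece_closed i j : zmod_closed (@cube_piece i j).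
Proof.
split=> [|u v]; rewrite !unfold_in.
  by apply/asboolP => s n; rewrite ffunE coef0 eqxx.
move=> /asboolP hu /asboolP hv; apply/asboolP => s n.
rewrite !ffunE coefB; have [u0|u0 _] := eqVneq ((u s : Rc)`_n) 0.
  by rewrite u0 sub0r oppr_eq0; apply: hv.
exact: hu.
Qed.

Definition cube_gmodule (i : int) : gmodule := GModule (@cube_piece_closed i).

(* Matrix entry of xi_a(L) from the labelling S of the circles of D(L) to the
   labelling T of those of D(L + a).  The circles which do not meet a are common
   to both; there xi_a is the identity. *)
Definition xi_coef (a : pt) (L : {set pt}) (S T : {set pt}) : Rc :=
  let K := circles L in
  let K' := circles (a |: L) in
  if S :&: K' == T :&: K then
    match enum (K :\: K'), enum (K' :\: K) with
    | [:: C1; C2], [:: C] => m_coef (C1 \in S) (C2 \in S) (C \in T)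
    | [:: C], [:: C1; C2] => Delta_coef (C \in S) (C1 \in T) (C2 \in T)
    | _, _ => 0
    end
  else 0.

(* le is the chosen order on the double points. *)
Definition d_coef (le : rel pt) (s t : {set pt} * {set pt}) : Rc :=
  \sum_(a in double_points D :\: s.1 | t.1 == a |: s.1)
    (-1) ^+ #|[set b in s.1 | ~~ le b a]| * xi_coef a s.1 s.2 t.2.

Definition cube_diff (le : rel pt) (i k : int) (v : cube i) : cube k :=
  [ffun t => \sum_s d_coef le (val s) (val t) * (v s : Rc)].

Lemma cube_diff_linear le i k : linear (@cube_diff le i k).
Proof.
move=> a u v; apply/ffunP => t; rewrite !ffunE scaler_sumr -big_split /=.
apply: eq_bigr => s _; rewrite !ffunE /= mulrDr; congr (_ + _).
by rewrite /GRing.scale /= mulrCA.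
Qed.
HB.instance Definition _ le i k :=
  GRing.isLinear.Build Rc (cube i) (cube k) _ (@cube_diff le i k)
    (@cube_diff_linear le i k).

Definition Cbar (le : rel pt) : gcomplex :=
  GComplex (cochain := cube_gmodule) (fun i k => @cube_diff le i k).

Definition khovanov_complex (le : rel pt) (o : pred (dart D)) : gcomplex :=
  cgshift (cshift (Cbar le) (xcross o)%:Z)
    ((xcross o)%:Z *+ 2 - (ycross o)%:Z).

Definition khovanov (le : rel pt) (o : pred (dart D)) (i : int) : gmodule :=
  cohomology (khovanov_complex le o) i.

Definition double_point_order (le : rel pt) : Prop :=
  [/\ {in double_points D &, antisymmetric le},
      {in double_points D & &, transitive le} &
      {in double_points D &, total le}].

End Khovanov.

Definition alternating_chi_hat (H : int -> gmodule) : laurent :=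
  fun j => \sum_(i \in [set: int]%classic) (-1) ^ i * chi_hat (H i) j.

(* Main.v *)
From HB Require Import structures.
From mathcomp Require Import boolp classical_sets functions cardinality fsbigop.
From mathcomp Require Import all_boot all_order all_algebra all_fingroup.
From mathcomp Require Import generic_quotient.
From mathcomp Require Import zify ring.
Require Import Defs.

(** Let st_j be the sum of (-1)^|L| over the pairs (L, S) of degree j, where L is a set of
    double points and S a set of circles of D(L); its generating function is the expansion of
    the Kauffman bracket over all states (state_sum). Both sides of the theorem are equal to
    it, up to the same sign and shift.

    The left-hand side. The skein relation has the same effect on the bracket and on the state
    sum (state_sum_skein), and on diagrams without double points both are powers of q + 1/q
    (bracket_loops, state_sum_loops). As the axioms of the bracket concern plane diagrams only,
    planarity has to be preserved by smoothing a double point (planar_resolve). A smoothing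
    multiplies the vertex permutation, and hence the face permutation, by a transposition;
    counting cycles and components shows that the genus does not increase (genus_split) and,
    by the same argument repeated, that it is never negative (euler_inequality).

    The right-hand side. In a fixed degree the complex consists of free abelian groups of
    finite rank, with the monomials c^n s as bases. Tensored with the rationals, its cohomology
    has the same alternating sum of dimensions as the complex itself
    (alternating_chi_khovanov). Multiplication by 1 - q^2 leaves the monomials without c
    (reaches_step), and these are the pairs (L, S).

    Passing from the cohomology to the complex requires the differential to square to zero
    (d_coef_sq), that is, the faces of the cube to commute (xi_square). Two observations
    replace the usual inspection of pictures.
    First, a plane diagram has an orientation of its edges that alternates between incoming
    and outgoing around each double point (planar_alternating). All smoothings respect it, so
    the circles of a state are the cycles of a permutation of the outgoing darts, and changing
    the smoothing at a double point multiplies this permutation by the transposition of the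
    two outgoing darts x and y there. Hence the circles of x and y are either merged or split,
    and the partitions of the darts into circles before and after agree once x and y are
    identified (surgery).
    Second, the module of a state is a cyclic module over the ring generated by the
    multiplications by X at the darts, and the maps of the cube commute with these
    (xi_equivariant). They are therefore determined by their value on the labelling of all
    circles by 1, which is 1 for a merge and Delta(1) for a split (xi_vacuum), and a face of
    the cube commutes as soon as two products of elements Delta(1) agree. *)

Set Implicit Arguments.
Unset Strict Implicit.
Unset Printing Implicit Defensive.

Import Order.TTheory GRing.Theory Num.Theory.
Local Open Scope ring_scope.
Local Notation Rc := {poly int}.

(** * Joining two classes of an equivalence relation *)

Section Joins.
Context (T : finType).
Implicit Types (e : rel T) (E F : rel T).

Definition is_equiv E := [/\ reflexive E, symmetric E & transitive E].

(** The equivalence relation generated by the equivalence relation E and the pair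
    (x, y): a chain needs the added pair at most once. *)
Definition joins E (x y : T) : rel T :=
  fun u v => [|| E u v, E u x && E y v | E u y && E x v].

Lemma connect_equiv e : connect_sym e -> is_equiv (connect e).
Proof. by move=> es; split; [exact: connect0 | | exact: connect_trans]. Qed.

Lemma connect_min e F :
  is_equiv F -> subrel e F -> subrel (connect e) F.
Proof.
case=> Fr _ Ft eF x _ /connectP[p e_p ->].
by elim: p x e_p => //= y p IHp x /andP[/eF exy /IHp]; apply: Ft.
Qed.

Lemma joins_sub E F x y :
  is_equiv F -> subrel E F -> F x y -> subrel (joins E x y) F.
Proof.
case=> Fr Fs Ft EF Fxy u v /or3P[/EF//|/andP[/EF ux /EF yv]|/andP[/EF uy /EF xv]].
  exact: Ft (Ft _ _ _ ux Fxy) yv.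
by rewrite Fs in Fxy; exact: Ft (Ft _ _ _ uy Fxy) xv.
Qed.

Lemma sub_joins E x y : subrel E (joins E x y).
Proof. by move=> u v Euv; rewrite /joins Euv. Qed.

Lemma joins_pair E x y : is_equiv E -> joins E x y x y.
Proof. by case=> Er _ _; rewrite /joins !Er orbT. Qed.

Lemma joins_equiv E x y : is_equiv E -> is_equiv (joins E x y).
Proof.
case=> Er Es Et.
have Esl := sym_left_transitive Es Et; have Esr := sym_right_transitive Es Et.
split; first by move=> u; rewrite /joins Er.
  move=> u v; rewrite /joins (Es u v) (Es u x) (Es y v) (Es u y) (Es x v).
  by case: (E v u); case: (E x u); case: (E v y); case: (E y u); case: (E v x).
move=> v u w /or3P[uv|/andP[ux yv]|/andP[uy xv]].
- by rewrite /joins !(Esl _ _ uv).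
- rewrite /joins -!(Esl _ _ yv) Er ux (Esl _ _ ux w) /=.
  by case/or3P=> [->|/andP[_ ->]|->]; rewrite ?orbT.
- rewrite /joins -!(Esl _ _ xv) Er uy (Esl _ _ uy w) /=.
  by case/or3P=> [->|->|/andP[_ ->]]; rewrite ?orbT.
Qed.

(** Only the classes of x and y are affected, and they become one: the
    components meeting {x, y} are counted on both sides, the others agree. *)
Lemma n_comp_joins e e' x y : connect_sym e -> connect_sym e' ->
  connect e' =2 joins (connect e) x y ->
  n_comp e T = (n_comp e' T + ~~ connect e x y)%N.
Proof.
move=> se se' ee'.
pose a := closure e (pred2 x y).
have aE u : (u \in a) = connect e u x || connect e u y.
  rewrite /a unfold_in /closure_mem.
  apply/pred0Pn/orP=> [[z /andP[/= uz /pred2P[<-|<-]]]|[]uz]; [by left|by right| |].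
    by exists x; apply/andP; split; rewrite //= inE eqxx.
  by exists y; apply/andP; split; rewrite //= inE eqxx orbT.
have a'E : a =i connect e' x.
  move=> u; rewrite aE [RHS]ee' /joins connect0 /= (se u x) (se u y).
  by case: (connect e x u); case: (connect e y u); rewrite ?orbT ?andbF.
rewrite (n_compC a) (n_compC a e') (n_comp_closure2 se).
rewrite (eq_n_comp_r a'E) (n_comp_connect se') addnAC add1n; congr (_.+1 + _)%N; last first.
apply: eq_card => u; rewrite !inE.
have [//|ua] := boolP (u \in a); rewrite /= ?andbT ?andbF //.
rewrite /roots /root; congr (odflt _ _ == _); apply: eq_pick => v.
rewrite ee' /joins; move: ua; rewrite aE negb_or => /andP[/negPf-> /negPf->].
by rewrite !orbF.
Qed.

End Joins.

(** * Transpositions and the Euler inequality for pairs of permutations *)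

Section Classes.
Context (T : finType).

(** Bridge between components counted as sets (the circles of a state) and
    components counted by canonical roots (the faces and vertices of a map). *)
Lemma card_classes (e : rel T) : connect_sym e ->
  #|[set [set y | connect e x y] | x in T]%SET| = n_comp e T.
Proof.
move=> es; pose cls x := [set y | connect e x y]%SET.
have clsP x y : (cls x == cls y) = connect e x y.
  apply/eqP/idP => [/setP/(_ y)|xy]; first by rewrite !inE connect0.
  by apply/setP=> z; rewrite !inE (same_connect es xy).
rewrite -(_ : [set cls x | x in roots e]%SET = [set cls x | x in T]%SET).
  rewrite card_in_imset => [|x y /eqP rx /eqP ry /eqP].
    by apply: eq_card => x; rewrite !inE andbT.
  by rewrite clsP => /(fingraph.rootP es); rewrite rx ry.
apply/setP=> c; apply/imsetP/imsetP => -[x xP ->].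
  by exists x.
exists (fingraph.root e x); first exact: roots_root.
by apply/eqP; rewrite clsP connect_root.
Qed.

Lemma porbitE (s : {perm T}) x : porbit s x = [set y | fconnect s x y]%SET.
Proof.
apply/setP=> y; rewrite inE; apply/porbitP/idP => [[i ->]|/iter_findex <-].
  by rewrite permX fconnect_iter.
by exists (findex s x y); rewrite permX.
Qed.

Lemma fconnect_porbit (s : {perm T}) x y : fconnect s x y = (y \in porbit s x).
Proof. by rewrite porbitE inE. Qed.

Lemma fcard_porbits (s : {perm T}) : fcard s T = #|porbits s|.
Proof.
rewrite -card_classes; last by apply: fconnect_sym; apply: perm_inj.
by congr #|pred_of_set _|; apply: eq_imset => x; rewrite porbitE.
Qed.

End Classes.

Section Transpositions.
Context (T : finType).
Implicit Types (s a r : {perm T}) (x y : T).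
Local Open Scope group_scope.

(** Multiplying by a transposition on the right is multiplying the inverse on
    the left; the two arguments of tperm are then swapped after s is applied. *)
Lemma porbits_tperm_mul s x y :
  (#|porbits (s * tperm x y)| + (x \notin porbit s y).*2 = #|porbits s| + (x != y))%N.
Proof.
have := porbits_mul_tperm s^-1 x y.
by rewrite /= porbitV -{1}(tpermV x y) -invMg !porbitsV.
Qed.

(** The number of cycles changes by exactly one in a direction dictated by
    whether x and y share a cycle, so applying the transposition twice shows that
    x and y share a cycle on exactly one side. *)
Lemma porbit_tperm_mul s x y : x != y ->
  (x \in porbit (s * tperm x y) y) = (x \notin porbit s y).
Proof.
move=> xy; have h1 := porbits_tperm_mul s x y.
have h2 := porbits_tperm_mul (s * tperm x y) x y.
rewrite -mulgA tperm2 mulg1 xy in h1 h2.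
by move: h1 h2; case: (x \in porbit s y); case: (x \in _) => //=; lia.
Qed.

Definition same_porbit s : rel T := fun x y => y \in porbit s x.

Lemma same_porbit_equiv s : is_equiv (same_porbit s).
Proof.
split=> [x|x y|y x z]; rewrite /same_porbit ?porbit_id 1?porbit_sym //.
by rewrite -!eq_porbit_mem => /eqP<- /eqP->.
Qed.

Lemma same_porbit_min s F :
  is_equiv F -> (forall x, F x (s x)) -> subrel (same_porbit s) F.
Proof.
move=> eqF sF x y; rewrite /same_porbit -fconnect_porbit.
by apply: connect_min => // u v /eqP <-.
Qed.

(** The other half of what a transposition does to the cycles: once x and y are
    identified, the two partitions into cycles are indistinguishable. *)
Lemma joins_porbit s x y :
  joins (same_porbit (s * tperm x y)) x y =2 joins (same_porbit s) x y.
Proof.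
have sub s' : subrel (joins (same_porbit (s' * tperm x y)) x y) (joins (same_porbit s') x y).
  have eqJ := joins_equiv x y (same_porbit_equiv s').
  have Jxy : joins (same_porbit s') x y x y := joins_pair x y (same_porbit_equiv s').
  have [Jr Js Jt] := eqJ.
  apply: joins_sub => //; apply: same_porbit_min => // u.
  have us : joins (same_porbit s') x y u (s' u).
    by apply: sub_joins; rewrite /same_porbit (mem_porbit s' 1).
  rewrite permM; case: tpermP => // e; rewrite e in us; apply: Jt us _ => //.
  by rewrite Js.
move=> u v; apply/idP/idP; first exact: sub.
have := sub (s * tperm x y) u v.
by rewrite -mulgA tperm2 mulg1.
Qed.

(** The edges of the graph whose components are the orbits of the group
    generated by a and r. *)
Definition step a r : rel T := [rel u v | (v == a u) || (v == r u)].

Lemma step_sym a r : connect_sym (step a r).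
Proof.
have e : step a r =2 relU (frel a) (frel r).
  by move=> u v; rewrite /step /= !(eq_sym v).
move=> u v; rewrite !(eq_connect e); apply: relU_sym;
  by apply: fconnect_sym; apply: perm_inj.
Qed.

Lemma step_min a r F :
  is_equiv F -> (forall u, F u (a u)) -> (forall u, F u (r u)) ->
  subrel (connect (step a r)) F.
Proof.
by move=> eqF Fa Fr; apply: connect_min => // u v /orP[]/eqP->.
Qed.

Lemma same_porbit_step s a r :
  (forall u, connect (step a r) u (s u)) ->
  subrel (same_porbit s) (connect (step a r)).
Proof. by apply: same_porbit_min; apply: connect_equiv; apply: step_sym. Qed.

Lemma connect_stepl a r u : connect (step a r) u (a u).
Proof. by apply: connect1; rewrite /step /= eqxx. Qed.

Lemma connect_stepr a r u : connect (step a r) u (r u).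
Proof. by apply: connect1; rewrite /step /= eqxx orbT. Qed.

Lemma connect_step_mul a r u : connect (step a r) u ((a * r) u).
Proof. by rewrite permM (connect_trans (connect_stepl a r u)) ?connect_stepr. Qed.

Section Split.
Context (a r : {perm T}) (x y : T).
Hypothesis (xy : x != y) (rxy : x \in porbit r y).
Let r' := r * tperm x y.

Lemma porbits_split : #|porbits r'| = (#|porbits r|).+1.
Proof.
have := porbits_tperm_mul r x y; rewrite rxy xy -/r'; lia.
Qed.

Lemma connect_split : connect (step a r) =2 joins (connect (step a r')) x y.
Proof.
have eq' := connect_equiv (@step_sym a r').
have eq0 := connect_equiv (@step_sym a r).
have eqJ := joins_equiv x y eq'.
have cxy : connect (step a r) x y.
  apply: same_porbit_step (r) _ _ _ _ => [u|]; first exact: connect_stepr.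
  by rewrite /same_porbit porbit_sym.
have [_ cs ct] := eq0; have [_ Js Jt] := eqJ.
move=> u v; apply/idP/idP.
  apply: step_min => // w; first by apply: sub_joins; apply: connect_stepl.
  have : joins (connect (step a r')) x y w (r' w).
    by apply: sub_joins; apply: connect_stepr.
  rewrite permM; case: tpermP => // -> wJ; apply: Jt wJ _; last first.
    exact: joins_pair.
  by rewrite Js; apply: joins_pair.
apply: joins_sub => //; apply: step_min => // w; first exact: connect_stepl.
have : connect (step a r) w (r w) by exact: connect_stepr.
rewrite permM; case: tpermP => // -> wJ; apply: ct wJ _ => //.
by rewrite cs.
Qed.

Lemma n_comp_split :
  n_comp (step a r') T = (n_comp (step a r) T + ~~ connect (step a r') x y)%N.
Proof. exact/n_comp_joins/connect_split/step_sym/step_sym. Qed.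

Lemma faces_split :
  (#|porbits (a * r')| + (x \notin porbit (a * r) y).*2 = #|porbits (a * r)| + 1)%N.
Proof. by rewrite mulgA porbits_tperm_mul xy. Qed.

Lemma faces_splitE :
  (x \in porbit (a * r') y) = (x \notin porbit (a * r) y).
Proof. by rewrite mulgA porbit_tperm_mul. Qed.

Lemma faces_connect : x \in porbit (a * r') y -> connect (step a r') x y.
Proof.
rewrite porbit_sym; apply: same_porbit_step => u; exact: connect_step_mul.
Qed.

(** The quantity 2 #components - #cycles of r - #faces does not increase when a
    cycle of r is split. If the split disconnects x from y, they cannot lie in one
    face afterwards, so the transposition has created a new face, which compensates
    for the new component; otherwise the number of components is unchanged and
    that of faces drops by at most one, while r gains a cycle. *)
Lemma genus_split :
  (#|porbits (a * r)| + (n_comp (step a r') T).*2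
     <= #|porbits (a * r')| + (n_comp (step a r) T).*2 + 1)%N.
Proof.
have := faces_connect; have := faces_splitE; have := faces_split.
rewrite n_comp_split; case: (x \in porbit (a * r) y) => /= h3 -> => [_|->//].
  by case: (connect _ _ _); lia.
by rewrite addn0; lia.
Qed.

End Split.

Lemma n_comp_step1 a : n_comp (step a 1) T = #|porbits a|.
Proof.
rewrite -fcard_porbits; apply: eq_n_comp => u v; apply/idP/idP.
  apply: step_min; first by apply/connect_equiv/fconnect_sym/perm_inj.
    exact: fconnect1.
  by move=> w; rewrite perm1 connect0.
by apply: connect_sub => {u v} u v /= /eqP <-; apply: connect_stepl.
Qed.

(** Nonnegativity of the genus. Splitting off fixed points of r one by one does
    not increase the genus by genus_split, and ends at r = 1, where it is zero. *)
Lemma euler_inequality a r :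
  (#|porbits a| + #|porbits r| + #|porbits (a * r)|
     <= #|T| + (n_comp (step a r) T).*2)%N.
Proof.
(* Induction on the number of points of T in excess of the cycles of r. *)
have [k] := ubnP (#|T| - #|porbits r|); elim: k r => // k IHk r le_k.
have [->|/eqP r1] := eqVneq r 1.
  rewrite mulg1 n_comp_step1 -addnn addnAC [X in (X <= _)%N]addnC leq_add2r.
  exact: leq_imset_card.
have [x rx] : exists x, x != r x.
  apply: contrapT => nx; apply: r1; apply/permP => x; rewrite perm1.
  by apply/esym/eqP/negPn/negP => nrx; apply: nx; exists x.
have xr : x \in porbit r (r x) by rewrite porbit_sym (mem_porbit r 1).
have := IHk (r * tperm x (r x)).
have := porbits_split rx xr; have := genus_split a rx xr.
have : (#|porbits (r * tperm x (r x))| <= #|T|)%N by exact: leq_imset_card.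
lia.
Qed.

End Transpositions.

(** * Pairs of fixed-point-free involutions *)

Section Involutions.
Context (T : finType).
Implicit Types (s : {perm T}).

Lemma card_involution s : involutive s -> (forall x, s x != x) ->
  #|T| = (#|porbits s|).*2.
Proof.
move=> sK sN; rewrite -fcard_porbits -muln2 -(@fcard_order_set _ s perm_inj 2 T) //.
apply/fintype.subsetP => x _; rewrite inE; apply/eqP.
apply: (order_cycle (p := [:: x; s x])); last by rewrite !inE eqxx.
  by rewrite /= sK !eqxx.
by rewrite /= inE eq_sym sN.
Qed.

Context (a r : {perm T}).
Hypotheses (aK : involutive a) (rK : involutive r).
Let f := (a * r)%g.

(** An orbit of the dihedral group generated by a and r is the cycle of a * r
    through z together with its image under a. *)
Lemma closed_component z :
  closed (step a r) [pred u | (u \in porbit f z) || (a u \in porbit f z)].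
Proof.
have fP u : (f u \in porbit f z) = (u \in porbit f z).
  by rewrite -!eq_porbit_mem -[f u](_ : (f ^+ 1)%g u = _) ?porbit_perm.
apply: intro_closed; first exact: step_sym.
move=> u v; rewrite /step /= => /orP[]/eqP->; rewrite !inE ?aK 1?orbC //.
by rewrite -(fP (a u)) -(fP (a (r u))) /f !permM !aK rK.
Qed.

Lemma component z u : connect (step a r) z u ->
  (u \in porbit f z) || (a u \in porbit f z).
Proof.
move=> /(closed_connect (closed_component z)) /=.
by rewrite !inE porbit_id => <-.
Qed.

Lemma porbit_component z u : u \in porbit f z -> connect (step a r) z u.
Proof. by apply: same_porbit_step => w; apply: connect_step_mul. Qed.

Hypotheses (aN : forall x, a x != x) (rN : forall x, r x != x).

(** The two halves of a dihedral orbit are disjoint: a z = f^i z can be pushed to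
    a (f z) = f^(i - 2) (f z), and for i = 0 or i = 1 it yields a fixed point of a
    or of r. *)
Lemma notin_porbit z : a z \notin porbit f z.
Proof.
apply/porbitP => -[i]; elim/ltn_ind: i z => -[|[|i]] IHi z.
- by rewrite perm1 => /eqP; rewrite (negPf (aN z)).
- by rewrite expg1 permM => /eqP; rewrite eq_sym (negPf (rN _)).
rewrite expgSr permM => e; have {}e : a (r (a z)) = (f ^+ i.+1)%g z.
  by rewrite e /f permM rK aK.
apply: (IHi i _ (f z)) => //.
by rewrite {1}/f permM e expgS permM /f permM.
Qed.

(** The inequality of one direction is the Euler inequality; for the other, the
    two halves of each dihedral orbit are distinct cycles. *)
Lemma card_faces_involutions :
  #|porbits f| = (n_comp (step a r) T).*2.
Proof.
apply/eqP; rewrite eqn_leq; apply/andP; split.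
  have := euler_inequality a r.
  rewrite (card_involution aK aN) -/f.
  have := card_involution rK rN; rewrite (card_involution aK aN); lia.
(* R has one point z in each orbit; the pair (z, b) selects the half through z or a z. *)
pose R := [set z | (fingraph.root (step a r) z == z)]%SET.
pose g (zb : T * bool) := porbit f (if zb.2 then zb.1 else a zb.1).
have <- : #|finset.setX R [set: bool]%SET| = (n_comp (step a r) T).*2.
  rewrite cardsX cardsT card_bool muln2; congr (_.*2).
  by apply: eq_card => z; rewrite !inE andbT.
rewrite -(card_in_imset (f := g)).
  apply: subset_leq_card; apply/fintype.subsetP => c /imsetP[zb _ ->].
  exact: imset_f.
have cg zb u : u \in g zb -> connect (step a r) zb.1 u.
  rewrite /g; case: zb => z [] /=; first exact: porbit_component.
  by move=> /porbit_component; apply: connect_trans; apply: connect_stepl.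
move=> [z b] [z' b'] /=; rewrite !inE !andbT /= => /eqP rz /eqP rz' e.
have zz' : z = z'.
  rewrite -rz -rz'; apply/(fingraph.rootP (@step_sym _ a r)).
  pose u := if b then z else a z.
  have ug : u \in g (z, b) by apply: porbit_id.
  have ug' := ug; rewrite e in ug'.
  by apply: connect_trans (cg _ _ ug) _; rewrite step_sym; exact: (cg _ _ ug').
congr pair => //; move: e; rewrite -zz' /g /=.
have := notin_porbit z; rewrite -eq_porbit_mem.
by case: b b' => -[] //= /eqP nz e; case: nz; rewrite e.
Qed.

End Involutions.

Section Alternation.
Context (T : finType) (a r : {perm T}).
Hypotheses (aK : involutive a) (rK : involutive r).
Let f := (a * r)%g.
Hypotheses (aN : forall x, a x != x) (rN : forall x, r x != x).

(** Colour one of the two halves of each dihedral orbit. *)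
Lemma alternation_involutions :
  exists o : pred T, forall x, o (a x) = ~~ o x /\ o (r x) = ~~ o x.
Proof.
pose rt := fingraph.root (step a r).
pose o x := x \in porbit f (rt x).
have oa x : o (a x) = ~~ o x.
  have cz : connect (step a r) (rt x) x by rewrite step_sym connect_root.
  have rta : rt (a x) = rt x.
    by apply/esym/(fingraph.rootP (@step_sym _ a r))/connect_stepl.
  rewrite /o rta; apply/idP/idP => [ax|nx]; last first.
    by have := component aK rK cz; rewrite -/f (negPf nx).
  apply/negP => ox; have := notin_porbit aK rK aN rN x.
  by rewrite -eq_porbit_mem -/f; move: ax ox; rewrite -!eq_porbit_mem => /eqP-> /eqP->; rewrite eqxx.
exists o => x; split=> //; rewrite -oa.
have rtr : rt (r x) = rt (a x).
  by apply/(fingraph.rootP (@step_sym _ a r)); rewrite step_sym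
    (connect_trans _ (connect_stepr a r x)) // step_sym connect_stepl.
rewrite /o rtr -!eq_porbit_mem.
by rewrite -[r x](_ : (f ^+ 1)%g (a x) = _) ?porbit_perm // permM aK.
Qed.

End Alternation.

(** * The genus of a diagram and of its resolutions *)

Section DiagramPerms.
Context (D : diagram).
Implicit Types p x y : dart D.

Lemma rot_inj : injective (@rot D).
Proof.
by apply: (can_inj (g := fun x => rot (rot (rot x)))) => y; rewrite rot4.
Qed.

Lemma arc_inj : injective (@arc D).
Proof. exact: inv_inj (@arcK D). Qed.

Definition rotp : {perm dart D} := perm rot_inj.
Definition arcp : {perm dart D} := perm arc_inj.

Lemma card_darts : #|dart D| = (#|porbits arcp|).*2.
Proof. by apply: card_involution => p; rewrite !permE ?arcK ?arc_neq. Qed.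

Lemma planarE : planar D <->
  (#|porbits rotp| + #|porbits (arcp * rotp)%g|
   = #|porbits arcp| + (n_comp (step arcp rotp) (dart D)).*2)%N.
Proof.
rewrite -!fcard_porbits /planar.
rewrite (eq_fcard (f := @rot D) (f' := rotp)); last by move=> x; rewrite permE.
rewrite (eq_fcard (f := @arc D) (f' := arcp)); last by move=> x; rewrite permE.
rewrite (eq_fcard (f := fun p => rot (arc p)) (f' := (arcp * rotp)%g)); last first.
  by move=> x; rewrite permM !permE.
rewrite (@eq_n_comp _ [rel p p' | (p' == arc p) || (p' == rot p)] (step arcp rotp)) //.
by apply: eq_connect => u v; rewrite /step /= !permE.
Qed.

Lemma genus_ge0 :
  (#|porbits rotp| + #|porbits (arcp * rotp)%g|
   <= #|porbits arcp| + (n_comp (step arcp rotp) (dart D)).*2)%N.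
Proof. have := euler_inequality arcp rotp; rewrite card_darts; lia. Qed.

Lemma mem_vertex p : p \in vertex p.
Proof. by rewrite !inE eqxx. Qed.

Lemma vertex_rotE p : vertex (rot p) = vertex p.
Proof.
apply/setP => x; rewrite !inE rot4.
by case: (x == p); rewrite ?orbT ?orbF.
Qed.

Lemma vertex_eq p x : x \in vertex p -> vertex x = vertex p.
Proof. by rewrite !inE -!orbA => /or4P[]/eqP->; rewrite ?vertex_rotE. Qed.

Lemma double_rot p : is_double (rot p) = is_double p.
Proof. by rewrite /is_double (inj_eq rot_inj). Qed.

Lemma double_vertex p x : x \in vertex p -> is_double x = is_double p.
Proof. by rewrite !inE -!orbA => /or4P[]/eqP->; rewrite ?double_rot. Qed.

Lemma mem_double_points p : (vertex p \in double_points D) = is_double p.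
Proof.
apply/imsetP/idP => [[x xd e]|pd]; last by exists p.
by rewrite (@double_vertex x) // -e mem_vertex.
Qed.

Lemma porbit_rot2 p : p \in porbit rotp (rot (rot p)).
Proof. by rewrite porbit_sym -[rot (rot p)](_ : (rotp ^+ 2)%g p = _) ?mem_porbit // permX /= !permE. Qed.

Lemma rot_neq3 p : rot (rot (rot p)) != p.
Proof. by apply/eqP => /(congr1 rot); rewrite rot4 => /eqP; rewrite eq_sym (negPf (rot_neq p)). Qed.

Lemma smooth_double (b : bool) p : is_double p -> over p = b ->
  [/\ smooth b p = rot p, smooth b (rot p) = p,
      smooth b (rot (rot p)) = rot (rot (rot p)) &
      smooth b (rot (rot (rot p))) = rot (rot p)].
Proof.
move=> pd pb; have pd1 : is_double (rot p) by rewrite double_rot.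
have pd2 : is_double (rot (rot p)) by rewrite double_rot.
have o1 := over_alt pd; have o2 := over_alt pd1; have o3 := over_alt pd2.
rewrite /smooth o3 o2 o1 pb negbK eqxx rot4.
by case: (b).
Qed.

End DiagramPerms.

(** A smoothing cuts the 4-cycle of a double point into two 2-cycles, which is
    multiplication by the transposition of two opposite darts. Taking for x an over
    dart for b = true and an under dart for b = false treats both smoothings alike. *)
Lemma rotp_resolve (D : diagram) (p : dart D) b : is_double p ->
  exists x, [/\ x \in vertex p, is_double x,
     over x = b &
     rotp (resolve p b) = (rotp D * tperm x (rot (rot x)))%g :> {perm dart D}].
Proof.
move=> pd; have [x [xp xd xb]] : exists x, [/\ x \in vertex p, is_double x & over x = b].
  have [<-|nb] := eqVneq (over p) b; first by exists p; rewrite mem_vertex.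
  exists (rot p); rewrite vertex_rot mem_vertex double_rot over_alt //.
  by split=> //; case: (over p) b nb => -[].
exists x; split=> //; apply/permP => u.
have -> : rotp (resolve p b) u = if u \in vertex p then smooth b u else rot u.
  by rewrite permE.
rewrite -(vertex_eq xp) permM [rotp D u]permE.
case: ifPn => [|ux]; last first.
  rewrite tpermD //; apply: contraNneq ux => e.
    by rewrite -vertex_rot -e mem_vertex.
  by rewrite -vertex_rot -e !vertex_rot mem_vertex.
have [e0 e1 e2 e3] := smooth_double xd xb.
rewrite !inE -!orbA => /or4P[]/eqP->.
- by rewrite e0 tpermD ?rot_neq // eq_sym rot_neq.
- by rewrite e1 tpermR.
- by rewrite e2 tpermD // eq_sym ?rot_neq3 ?rot_neq.
- by rewrite e3 rot4 tpermL.
Qed.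

Lemma arcp_resolve (D : diagram) (p : dart D) b :
  arcp (resolve p b) = arcp D :> {perm dart D}.
Proof. by apply/permP => u; rewrite !permE. Qed.

(** The genus is nonnegative and does not increase, hence stays zero. This is
    what allows the skein relation to be applied repeatedly. *)
Lemma planar_resolve (D : diagram) (p : dart D) b :
  planar D -> is_double p -> planar (resolve p b).
Proof.
move=> /planarE plD pd; apply/planarE.
have [x [_ xd _ er]] := rotp_resolve b pd.
have := genus_ge0 (resolve p b).
rewrite -[dart (resolve p b)]/(dart D) arcp_resolve er.
have xn : x != rot (rot x) by rewrite eq_sym.
have := porbits_split xn (porbit_rot2 x).
have := genus_split (arcp D) xn (porbit_rot2 x).
by move=> h1 -> h2; move: plD h1 h2; lia.
Qed.

(** * Source-sink orientations of plane diagrams *)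

Section ResolvedPoints.
Context (D : diagram) (p : dart D) (b : bool).

Lemma is_double_resolve (x : dart D) :
  is_double (x : dart (resolve p b)) = is_double x && (x \notin vertex p).
Proof.
rewrite /is_double /= /res_rot.
have [xp|xp] := boolP (x \in vertex p).
  by rewrite vertex_smooth xp smoothK eqxx andbF.
by rewrite vertex_rot (negPf xp) andbT.
Qed.

Lemma vertex_resolve (x : dart D) : x \notin vertex p ->
  vertex (x : dart (resolve p b)) = vertex x.
Proof.
move=> xp; rewrite /vertex /= /res_rot.
by rewrite !(vertex_rot, negPf xp).
Qed.

Lemma double_points_resolve :
  double_points (resolve p b) = (double_points D :\ vertex p)%SET
    :> {set {set dart D}}.
Proof.
apply/setP => c; rewrite in_setD1; apply/imsetP/andP => [[x]|[cp]].
  rewrite inE [is_double _]is_double_resolve => /andP[xd xp] cx.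
  have {cx} -> : c = vertex (x : dart D) by rewrite cx; apply: vertex_resolve.
  have xD : vertex (x : dart D) \in double_points D by rewrite mem_double_points.
  split; last exact: xD.
  by apply: contraNneq xp => <-; apply: mem_vertex.
case/imsetP=> x; rewrite inE => xd cx; exists x; last first.
  rewrite cx; apply/esym/vertex_resolve; apply: contraNN cp => xp.
  by rewrite cx (vertex_eq xp).
rewrite inE [is_double _]is_double_resolve xd /=; apply: contraNN cp => xp.
by rewrite cx (vertex_eq xp).
Qed.

End ResolvedPoints.

Section NoDoublePoints.
Context (D : diagram) (D0 : double_points D = finset.set0).

Lemma rotpK : involutive (rotp D).
Proof.
move=> x; rewrite !permE; apply/eqP; rewrite -[_ == _]negbK -/(is_double x).
by rewrite -mem_double_points D0 inE.
Qed.

Lemma arcpK (E : diagram) : involutive (arcp E).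
Proof. by move=> x; rewrite !permE arcK. Qed.

Lemma arcpN (E : diagram) (x : dart E) : arcp E x != x.
Proof. by rewrite permE arc_neq. Qed.

Lemma rotpN (E : diagram) (x : dart E) : rotp E x != x.
Proof. by rewrite permE rot_neq. Qed.

(** Without double points both permutations are fixed-point-free involutions,
    so that there are as many vertices as edges and twice as many faces as
    components. *)
Lemma planar_no_double_points : planar D.
Proof.
apply/planarE.
rewrite (card_faces_involutions (@arcpK D) rotpK (@arcpN D) (@rotpN D)); congr (_ + _)%N.
apply: double_inj; rewrite -card_darts.
exact/esym/(card_involution rotpK (@rotpN D)).
Qed.

End NoDoublePoints.

(** Orientation of the edges such that incoming and outgoing darts alternate
    around each vertex; equivalently a checkerboard colouring of the faces. *)
Definition alternating D (o : pred (dart D)) :=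
  forall p, o (arc p) = ~~ o p /\ o (rot p) = ~~ o p.

(** Induction on the number of double points: an alternating orientation of a
    resolution alternates around the restored vertex as soon as the two opposite
    darts x and y get the same colour. If x and y are not connected in the
    resolution, the colours of the component of y can be reversed. If they are,
    the genus formula forces the resolution to lose a face, so that x and y lie on
    a common cycle of the face permutation, which preserves the colours. *)
Lemma planar_alternating (D : diagram) : planar D ->
  exists o : pred (dart D), alternating o.
Proof.
have [n] := ubnP #|double_points D|; elim: n D => // n IHn D le_n plD.
have [D0|] := eqVneq (double_points D) finset.set0.
  have [o oP] := alternation_involutions (@arcpK D) (rotpK D0) (@arcpN D) (@rotpN D).
  by exists o => x; have := oP x; rewrite !permE.
case/set0Pn=> c /imsetP[p]; rewrite inE => pd _ {c}.
have dp : vertex p \in double_points D by rewrite mem_double_points.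
have [x [xp xd _ er]] := rotp_resolve false pd.
have plR := planar_resolve false plD pd.
set D' := resolve p false in er plR.
have [|o' altD'] := IHn D' _ plR.
  by move: le_n; rewrite double_points_resolve (cardsD1 (vertex p)) dp.
set y := rot (rot x) in er.
suff [o [oa or oxy]] : exists o : pred (dart D),
    [/\ forall u, o (arcp D u) = ~~ o u, forall u, o (rotp D' u) = ~~ o u & o x = o y].
  exists o => u; split; first by rewrite -oa permE.
  by rewrite -or er permM [rotp D u]permE; case: tpermP => // ->.
have xy : x != y by rewrite eq_sym.
have o'a u : o' (arcp D u) = ~~ o' u by rewrite permE; case: (altD' u).
have o'r u : o' (rotp D' u) = ~~ o' u by rewrite permE; case: (altD' u).
(* Here o' already works when x and y are connected, and has to be corrected otherwise. *)
have [cxy|ncxy] := boolP (connect (step (arcp D) (rotp D')) x y).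
  exists o'; split=> //.
  have : x \in porbit (arcp D * rotp D')%g y.
    rewrite er faces_splitE //.
    have := faces_split (arcp D) (rotp D) xy.
    have := n_comp_split (arcp D) (porbit_rot2 x); rewrite -/y -er cxy addn0.
    have := porbits_split xy (porbit_rot2 x); rewrite -/y -er.
    move/planarE: plD.
    have : (#|porbits (rotp D' : {perm dart D})| + #|porbits (arcp D * rotp D')%g|
      = #|porbits (arcp D)| + (n_comp (step (arcp D) (rotp D')) (dart D)).*2)%N.
      by move/planarE: plR; rewrite -(arcp_resolve p false).
    by case: (x \in porbit _ _) => //=; lia.
  pose F : rel (dart D) := fun u v => o' u == o' v.
  have eqF : is_equiv F.
    by split=> [u|u v|u v w]; rewrite /F ?eqxx // => /eqP->.
  have FS u : F u ((arcp D * rotp D')%g u) by rewrite /F permM o'r o'a negbK.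
  by move=> /(same_porbit_min eqF FS); rewrite /F => /eqP ->.
exists (fun u => o' u (+) (connect (step (arcp D) (rotp D')) y u && (o' x != o' y))).
split=> [u|u|].
- rewrite o'a -addNb; congr (_ (+) (_ && _)).
  by rewrite -!(step_sym _ _ _ y); apply/esym/(same_connect (@step_sym _ _ _))/connect_stepl.
- rewrite o'r -addNb; congr (_ (+) (_ && _)).
  by rewrite -!(step_sym _ _ _ y); apply/esym/(same_connect (@step_sym _ _ _))/connect_stepr.
rewrite connect0 step_sym (negPf ncxy) /=.
by case: (o' x); case: (o' y).
Qed.

(** * Changing one smoothing performs a surgery on the circles *)

Section AlternatingInvolutions.
Context (T : finType) (a : {perm T}) (aK : involutive a).
Context (o : pred T) (oa : forall u, o (a u) = ~~ o u).

(** A dart and its other end lie on the same circle, and exactly one of them is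
    outgoing; outward picks it. *)
Definition outward u := if o u then u else a u.

Section OneInvolution.
Context (r : {perm T}) (rK : involutive r) (or : forall u, o (r u) = ~~ o u).

(** First return to the outgoing darts when travelling along the circles. Its
    cycles are the circles, each seen only once, so that a surgery acts on it by a
    single transposition instead of two. *)
Definition return_map u := if o u then r (a u) else u.

Lemma return_map_inj : injective return_map.
Proof.
move=> u v; rewrite /return_map; case: ifP => ou; case: ifP => ov // e.
- by apply/perm_inj/perm_inj/e.
- by move: ov; rewrite -e or oa ou.
- by move: ou; rewrite e or oa ov.
Qed.

Definition return_perm : {perm T} := perm return_map_inj.

Lemma return_permE u : o u -> return_perm u = r (a u).
Proof. by move=> ou; rewrite permE /return_map ou. Qed.

Lemma connect_return u v :
  connect (step a r) u v = same_porbit return_perm (outward u) (outward v).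
Proof.
have P w : same_porbit return_perm w (return_perm w).
  by rewrite /same_porbit (mem_porbit _ 1).
have [Sr Ss St] := same_porbit_equiv return_perm.
have oout w : o (outward w) by rewrite /outward; case: ifP => // ow; rewrite oa ow.
have cout w : connect (step a r) w (outward w).
  by rewrite /outward; case: ifP => // ow; apply: connect_stepl.
apply/idP/idP => [|uv].
  (* The relation on the right is an equivalence, so it suffices to check single steps. *)
  pose F : rel T := fun u v => same_porbit return_perm (outward u) (outward v).
  have eqF : is_equiv F.
    by split=> [w|w w'|w w' w'']; rewrite /F //; apply: St.
  move: u v; apply: step_min => // u; rewrite -/(F _ _) /F /outward.
    by rewrite oa; case: (o u); rewrite /= ?aK.
  rewrite or; have [ou|ou] := boolP (o u) => /=; last first.
    by have := P (a u); rewrite return_permE ?oa // aK.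
  by have := P (a (r u)); rewrite return_permE ?oa ?or ?ou // aK rK Ss.
apply: connect_trans (cout u) _; rewrite step_sym; apply: connect_trans (cout v) _.
rewrite step_sym; apply: same_porbit_step uv => w.
rewrite permE /return_map; case: ifP => // _; rewrite -permM.
exact: connect_step_mul.
Qed.

End OneInvolution.

(** Two systems of arcs r and r' that differ by exchanging the targets x and y
    have return permutations that differ by the transposition of x and y. Hence x
    and y lie on a common circle for exactly one of them: a surgery of one circle
    into one circle is impossible. *)
Lemma surgery_involutions (r r' : {perm T}) x y :
  involutive r -> involutive r' ->
  (forall u, o (r u) = ~~ o u) -> (forall u, o (r' u) = ~~ o u) ->
  o x -> o y -> x != y -> (forall u, ~~ o u -> r' u = tperm x y (r u)) ->
  connect (step a r') x y = ~~ connect (step a r) x y /\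
  joins (connect (step a r')) x y =2 joins (connect (step a r)) x y.
Proof.
move=> rK r'K or or' ox oy xy er.
have ox' : outward x = x by rewrite /outward ox.
have oy' : outward y = y by rewrite /outward oy.
have es : return_perm or' = (return_perm or * tperm x y)%g.
  apply/permP => u; rewrite permM [LHS]permE [return_perm _ _]permE /return_map.
  case: ifPn => ou; first by rewrite er // oa ou.
  by rewrite tpermD //; apply: contraNneq ou => <-.
split.
  rewrite (connect_return rK or) (connect_return r'K or') ox' oy' es.
  by rewrite /same_porbit porbit_sym porbit_tperm_mul // porbit_sym.
move=> u v; have := joins_porbit (return_perm or) x y (outward u) (outward v).
by rewrite -es /joins !(connect_return rK or) !(connect_return r'K or') ox' oy'.
Qed.

End AlternatingInvolutions.

Section Smoothings.
Context (D : diagram).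
Implicit Types (L : {set {set dart D}}) (x y u v : dart D).

Lemma vertex_smoothE b x : vertex (smooth b x) = vertex x.
Proof. by rewrite /smooth; case: ifP => _; rewrite !vertex_rotE. Qed.

Lemma smoothingK L : involutive (smoothing L).
Proof. by move=> x; rewrite /smoothing vertex_smoothE smoothK. Qed.

Definition smoothp L : {perm dart D} := perm (inv_inj (smoothingK L)).

Lemma smoothpK L : involutive (smoothp L).
Proof. by move=> x; rewrite !permE smoothingK. Qed.

(** To lie on the same circle of the state L. *)
Definition conn L : rel (dart D) := connect (step (arcp D) (smoothp L)).

Lemma conn_sym L : symmetric (conn L).
Proof. exact: step_sym. Qed.

Lemma conn_equiv L : is_equiv (conn L).
Proof. exact/connect_equiv/step_sym. Qed.

Definition circle L x : {set dart D} := [set y | conn L x y]%SET.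

Lemma circlesE L : circles L = [set circle L x | x in dart D]%SET.
Proof.
rewrite /circles; apply: eq_imset => x; apply/setP => y; rewrite !inE.
by apply: eq_connect => u v; rewrite /step /= !permE.
Qed.

Lemma mem_circles L x : circle L x \in circles L.
Proof. by rewrite circlesE imset_f. Qed.

Lemma circlesP L c : reflect (exists x, c = circle L x) (c \in circles L).
Proof.
by rewrite circlesE; apply: (iffP imsetP) => [[x _ ->]|[x ->]]; exists x.
Qed.

Lemma eq_circle L x y : (circle L x == circle L y) = conn L x y.
Proof.
have [cr cs ct] := conn_equiv L.
apply/eqP/idP => [/setP/(_ y)|xy]; first by rewrite !inE cr.
by apply/setP=> z; rewrite !inE; apply: same_connect xy z; apply: step_sym.
Qed.

Lemma card_circles L : #|circles L| = n_comp (step (arcp D) (smoothp L)) (dart D).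
Proof. by rewrite -card_classes ?circlesE //; apply: step_sym. Qed.

(** The two outgoing darts at a double point lie on different strands of either
    smoothing, and changing the smoothing exchanges the strands ending there. *)
Lemma surgery (o : pred (dart D)) L x : alternating o -> is_double x -> o x ->
    vertex x \notin L ->
  let y := rot (rot x) in
  conn (vertex x |: L)%SET x y = ~~ conn L x y /\
  joins (conn (vertex x |: L)%SET) x y =2 joins (conn L) x y.
Proof.
move=> altD xd ox xL y.
have oa u : o (arcp D u) = ~~ o u by rewrite permE; case: (altD u).
have os L' u : o (smoothp L' u) = ~~ o u.
  rewrite permE /smoothing /smooth; case: ifP => _; first by case: (altD u).
  by rewrite !(altD _).2 negbK.
have oy : o y by rewrite !(altD _).2 negbK.
apply: (surgery_involutions (@arcpK D) oa (smoothpK L) (smoothpK _)) => //.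
  by rewrite eq_sym.
move=> u ou; rewrite [LHS]permE [smoothp L u]permE /smoothing inE in_set1.
have [ux|ux] := eqVneq (vertex u) (vertex x) => /=; last first.
  rewrite tpermD //; apply: contraNneq ux => e.
    by rewrite -(vertex_smoothE (vertex u \in L) u) -e.
  by rewrite -(vertex_smoothE (vertex u \in L) u) -e !vertex_rotE.
rewrite ux (negPf xL).
have : u \in vertex x by rewrite -ux mem_vertex.
rewrite /smooth /y !inE -!orbA => /or4P[]/eqP e; move: ou; rewrite e ?ox //;
  rewrite -/y ?oy // => _; case: (over _) => /=; rewrite ?rot4 ?tpermL ?tpermR //.
Qed.

End Smoothings.

(** * The matrix of a surgery in terms of darts *)

Section Surgered.
Context (T : finType) (E E' : rel T) (x y : T).
Hypotheses (eqE : is_equiv E) (eqE' : is_equiv E').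
Hypotheses (E'xy : E' x y = ~~ E x y) (EJ : joins E' x y =2 joins E x y).
Let J := joins E x y.

Lemma joinsx u : J x u = E x u || E y u.
Proof.
case: eqE => Er Es Et; rewrite /J /joins Er /=; case: (E x u); rewrite ?orbT //=.
by rewrite andbF orbF.
Qed.

(** Outside the joint class of x and y the added pair relates nothing, so E and E'
    both coincide with their common join: the circles that miss x and y persist. *)
Lemma out_joins u v : ~~ J x u -> E u v = E' u v.
Proof.
move=> Jxu; have [Er Es Et] := eqE.
have [E'r E's E't] := eqE'.
have : ~~ [|| E x u, E y u, E' x u | E' y u].
  apply: contra Jxu => /or4P[xu|yu|xu|yu].
  - by rewrite joinsx xu.
  - by rewrite joinsx yu orbT.
  - by rewrite /J -EJ /joins xu.
  - by rewrite /J -EJ /joins yu E'r orbT.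
rewrite !negb_or => /and4P[/negPf xu /negPf yu /negPf xu' /negPf yu'].
have : J u v = E u v by rewrite /J /joins [E u x]Es xu [E u y]Es yu !orbF.
by rewrite /J -EJ /joins [E' u x]E's xu' [E' u y]E's yu' !orbF => ->.
Qed.

(** A class of both E and E' through x or y would make E x y and E' x y equivalent:
    the circles through x and y do not survive. *)
Lemma in_joins u v : J x u -> ~ (E u =1 E' v).
Proof.
have [Er Es Et] := eqE; have [E'r E's E't] := eqE'.
have El := sym_left_transitive Es Et.
have E'l := sym_left_transitive E's E't.
move=> Jxu e; have uv : E' v u by rewrite -e Er.
have {uv}e w : E u w = E' u w by rewrite e (E'l _ _ uv).
move: Jxu; rewrite joinsx ![E _ u]Es.
have exy : E u x -> E u y = E x y by move=> ux; rewrite (El _ _ ux).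
have eyx : E u y -> E u x = E x y by move=> uy; rewrite (El _ _ uy) Es.
have e'xy : E u x -> E u y = ~~ E x y by rewrite -E'xy !e => ux; rewrite (E'l _ _ ux).
have e'yx : E u y -> E u x = ~~ E x y by rewrite -E'xy !e => uy; rewrite (E'l _ _ uy) E's.
case/orP=> [ux|uy].
  by have := exy ux; rewrite (e'xy ux); case: (E x y).
by have := eyx uy; rewrite (e'yx uy); case: (E x y).
Qed.

End Surgered.

Lemma enum_pair (T : finType) (c d : T) : c != d ->
  enum [set c; d]%SET = [:: c; d] \/ enum [set c; d]%SET = [:: d; c].
Proof.
move=> cd; have /(uniq_perm (enum_uniq _)) pe : uniq [:: c; d] by rewrite /= inE cd.
have {}pe : perm_eq (enum [set c; d]%SET) [:: c; d].
  by apply: pe => u; rewrite mem_enum !inE.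
have := perm_size pe; case: (enum _) pe => [|u [|v []]] // pe _.
have : u \in [:: c; d] by rewrite -(perm_mem pe) inE eqxx.
rewrite !inE => /orP[]/eqP ue; move: pe; rewrite ue => pe.
  left; move: pe; rewrite perm_cons => pe.
  by have := perm_mem pe d; rewrite !inE eqxx => /eqP ->.
right; have : perm_eq [:: d; v] [:: d; c].
  by apply: perm_trans pe _; rewrite (perm_catC [:: c] [:: d]).
rewrite perm_cons => {}pe.
by have := perm_mem pe c; rewrite !inE eqxx => /eqP ->.
Qed.

Lemma joins_xor (T : finType) (E : rel T) x y p : is_equiv E ->
  joins E x y x p -> ~~ E x y ->
  E x p && ~~ E y p || E y p && ~~ E x p.
Proof.
move=> eqE; rewrite (joinsx x y eqE); have [Er Es Et] := eqE => xyp.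
apply: contraNT; case/orP: xyp => [xp|yp]; rewrite ?xp ?yp ?andbT /=.
  by rewrite andbF orbF negbK => yp; apply: Et xp _; rewrite Es.
by rewrite ?andbF /= negbK => xp; apply: Et xp _; rewrite Es.
Qed.

Lemma Delta_coefC s t u : Delta_coef s t u = Delta_coef s u t.
Proof. by case: s; case: t; case: u. Qed.

Lemma m_coefC s t u : m_coef s t u = m_coef t s u.
Proof. by rewrite /m_coef andbC orbC. Qed.

(** The comultiplication of A is a map of A-modules. *)
Lemma Delta_linear_l (s t u : bool) :
  (if s then 0 else Delta_coef true t u) = (if t then Delta_coef s false u else 0).
Proof. by case: s; case: t; case: u. Qed.

(** The multiplication of A is a map of A-modules. *)
Lemma m_linear_l (s t u : bool) :
  (if s then 0 else m_coef true t u) = (if u then m_coef s t false else 0).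
Proof. by case: s; case: t; case: u. Qed.

Section Flip.
Context (D : diagram).
Implicit Types (L S T : {set {set dart D}}) (x y u v p : dart D).

(** The conclusion of surgery: the states L and L' differ by a merge or a split
    of the circles through x and y. The relation is symmetric, so statements about
    merges and splits are two readings of one statement. *)
Definition flips L L' x y :=
  conn L' x y = ~~ conn L x y /\ joins (conn L') x y =2 joins (conn L) x y.

Lemma flips_sym L L' x y : flips L L' x y -> flips L' L x y.
Proof. by case=> h J; split=> [|u v]; rewrite ?J // h negbK. Qed.

Lemma flips_diff L L' x y : flips L L' x y ->
  (circles L :\: circles L')%SET = [set circle L x; circle L y]%SET.
Proof.
move=> [h J]; have eqE := conn_equiv L; have eqE' := conn_equiv L'.
apply/setP => c; rewrite !inE; apply/andP/idP => [[cL' /circlesP[u cu]]|].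
  move: cL'; rewrite cu !eq_circle => uL'.
  case: (boolP (joins (conn L) x y x u)) => [|nJ].
    by rewrite (joinsx x y eqE) ![conn L u _]conn_sym.
  case/negP: uL'; suff -> : circle L u = circle L' u by apply: mem_circles.
  by apply/setP => v; rewrite !inE (out_joins eqE eqE' J).
move=> cxy; have [u cu Ju] : exists2 u, c = circle L u & joins (conn L) x y x u.
  have [cr _ _] := eqE.
  by case/orP: cxy => /eqP->; [exists x | exists y]; rewrite ?(joinsx x y eqE) ?cr ?orbT.
rewrite cu mem_circles; split=> //; apply/circlesP => -[v e].
by apply: (in_joins eqE eqE' h Ju (v := v)) => w; move/setP/(_ w): e; rewrite !inE.
Qed.

Definition agree L L' x y S T :=
  [forall u, joins (conn L) x y x u || ((circle L u \in S) == (circle L' u \in T))].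

Lemma agreeE L L' x y S T : flips L L' x y ->
  S \subset circles L -> T \subset circles L' ->
  (S :&: circles L' == T :&: circles L)%SET = agree L L' x y S T.
Proof.
move=> fl /fintype.subsetP SL /fintype.subsetP TL'; have [h J] := fl.
have eqE := conn_equiv L; have eqE' := conn_equiv L'.
have same u : ~~ joins (conn L) x y x u -> circle L u = circle L' u.
  by move=> nJ; apply/setP => v; rewrite !inE (out_joins eqE eqE' J).
have diff u : joins (conn L) x y x u -> circle L u \notin circles L'.
  move=> Ju; apply/circlesP => -[v e].
  by apply: (in_joins eqE eqE' h Ju (v := v)) => w; move/setP/(_ w): e; rewrite !inE.
have diff' u : joins (conn L') x y x u -> circle L' u \notin circles L.
  have h' : conn L x y = ~~ conn L' x y by rewrite h negbK.
  move=> Ju; apply/circlesP => -[v e].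
  by apply: (in_joins eqE' eqE h' Ju (v := v)) => w; move/setP/(_ w): e; rewrite !inE.
apply/eqP/forallP => [e u|e].
  case: (boolP (joins _ _ _ _ _)) => //= /same su.
  move/setP/(_ (circle L u)): e; rewrite !inE mem_circles andbT su mem_circles andbT.
  by move=> ->.
apply/setP => c; rewrite !inE; apply/andP/andP => -[cS cL].
  have /circlesP[u cu] := SL _ cS.
  have nJ : ~~ joins (conn L) x y x u by apply/negP => /diff; rewrite -cu cL.
  have := e u; rewrite (negPf nJ) /= -(same _ nJ) -cu cS => /eqP <-.
  by rewrite SL.
have /circlesP[u cu] := TL' _ cS.
have nJ : ~~ joins (conn L) x y x u.
  by rewrite -J; apply/negP => /diff'; rewrite -cu cL.
have := e u; rewrite (negPf nJ) /= (same _ nJ) -cu cS => /eqP ->.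
by rewrite TL'.
Qed.

Definition local_coef L L' x y S T : Rc :=
  if conn L x y then
    Delta_coef (circle L x \in S) (circle L' x \in T) (circle L' y \in T)
  else m_coef (circle L x \in S) (circle L y \in S) (circle L' x \in T).

(** The enumerations in xi_coef list the circles through x and y; their order is
    immaterial because the multiplication is commutative and the comultiplication
    cocommutative. *)
Lemma xi_coefE L x y S T : let L' := (vertex x |: L)%SET in flips L L' x y ->
  S \subset circles L -> T \subset circles L' ->
  xi_coef (vertex x) L S T =
    if agree L L' x y S T then local_coef L L' x y S T else 0.
Proof.
move=> L' fl SL TL'; rewrite /xi_coef -/L' (agreeE fl SL TL'); case: ifP => // _.
rewrite (flips_diff fl) (flips_diff (flips_sym fl)) /local_coef.
have [h _] := fl; case: ifPn => cxy.
  have -> : circle L y = circle L x by apply/eqP; rewrite eq_circle conn_sym.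
  rewrite setUid enum_set1.
  have ne : circle L' x != circle L' y by rewrite eq_circle h cxy.
  by case: (enum_pair ne) => ->; [|rewrite Delta_coefC].
have -> : circle L' y = circle L' x by apply/eqP; rewrite eq_circle conn_sym h cxy.
rewrite setUid enum_set1.
have ne : circle L x != circle L y by rewrite eq_circle.
by case: (enum_pair ne) => ->; [|rewrite m_coefC].
Qed.

(** Coefficient at S of the product of F by the variable X of the circle of p.
    Vectors are indexed by sets of circles labelled X, and X squares to zero. *)
Definition mulX L p (F : {set {set dart D}} -> Rc) S : Rc :=
  if circle L p \in S then F (S :\ circle L p)%SET else 0.

(** M commutes with multiplication by X at the circle of every dart, stated on
    the matrix: multiplying the basis vector S on the left gives either zero or the
    basis vector with one more circle. *)
Definition equivariant L L' (M : {set {set dart D}} -> {set {set dart D}} -> Rc) :=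
  forall p S T, S \subset circles L -> T \subset circles L' ->
  (if circle L p \in S then 0 else M (circle L p |: S)%SET T) = mulX L' p (M S) T.

(** Multiplication by X at p is local. On the circles through x and y this is
    the linearity of m and Delta over A; on the other circles the map is the
    identity. *)
Lemma xi_equivariant L x y : let L' := (vertex x |: L)%SET in flips L L' x y ->
  equivariant L L' (xi_coef (vertex x) L).
Proof.
move=> L' fl p S T SL TL'.
have pSL : (circle L p |: S)%SET \subset circles L by rewrite subUset sub1set mem_circles.
have pTL : (T :\ circle L' p)%SET \subset circles L' by rewrite (fintype.subset_trans (subsetDl _ _)).
rewrite /mulX !(xi_coefE fl) // -/L'.
have [h J] := fl.
have eqE := conn_equiv L; have eqE' := conn_equiv L'.
have [Er Es Et] := eqE; have [E'r E's E't] := eqE'.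
have pS u : (circle L u \in circle L p |: S)%SET = conn L u p || (circle L u \in S).
  by rewrite !inE eq_circle.
have pT u : (circle L' u \in T :\ circle L' p)%SET = ~~ conn L' u p && (circle L' u \in T).
  by rewrite !inE eq_circle.
(* Either p lies on a circle through x or y, or its circle is common to both states. *)
have [Jp|Jp] := boolP (joins (conn L) x y x p).
  have nJ u : ~~ joins (conn L) x y x u -> conn L u p = false /\ conn L' u p = false.
    have [Jr Js Jt] := joins_equiv x y eqE.
    have sub u' v' : conn L u' v' -> joins (conn L) x y u' v' by apply: sub_joins.
    have sub' u' v' : conn L' u' v' -> joins (conn L) x y u' v'.
      by rewrite -J; apply: sub_joins.
    by move=> nJu; split; apply: contraNF nJu => up; apply: (Jt _ _ _ Jp); rewrite Js; auto.
  have -> : agree L L' x y (circle L p |: S)%SET T = agree L L' x y S T.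
    apply: eq_forallb => u; rewrite pS.
    by case: (boolP (joins _ _ _ _ _)) => //= /nJ[-> _].
  have -> : agree L L' x y S (T :\ circle L' p)%SET = agree L L' x y S T.
    apply: eq_forallb => u; rewrite pT.
    by case: (boolP (joins _ _ _ _ _)) => //= /nJ[_ ->].
  case: (agree L L' x y S T); last by rewrite !if_same.
  rewrite /local_coef !pS !pT; have [cxy|cxy] := boolP (conn L x y).
    have xp : conn L x p.
      move: Jp; rewrite (joinsx x y eqE) => /orP[//|yp]; exact: (Et _ _ _ cxy yp).
    have -> : circle L p = circle L x by apply/eqP; rewrite eq_circle Es.
    have xy' : ~~ conn L' x y by rewrite h cxy.
    have : conn L' x p && ~~ conn L' y p || conn L' y p && ~~ conn L' x p.
      by apply: joins_xor => //; rewrite J.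
    case/orP=> /andP[up /negPf vp]; rewrite up vp xp !(orTb, andTb, andFb).
      have -> : circle L' p = circle L' x by apply/eqP; rewrite eq_circle E's.
      exact: Delta_linear_l.
    have -> : circle L' p = circle L' y by apply/eqP; rewrite eq_circle E's.
    by rewrite Delta_coefC Delta_linear_l Delta_coefC.
  have xy' : conn L' x y by rewrite h cxy.
  have xp' : conn L' x p.
    move: Jp; rewrite -J (joinsx x y eqE') => /orP[//|yp]; exact: (E't _ _ _ xy' yp).
  have -> : circle L' p = circle L' x by apply/eqP; rewrite eq_circle E's.
  have : conn L x p && ~~ conn L y p || conn L y p && ~~ conn L x p.
    exact: joins_xor.
  rewrite xp'; case/orP=> /andP[up /negPf vp]; rewrite up vp !(orTb, orFb, andFb).
    have -> : circle L p = circle L x by apply/eqP; rewrite eq_circle Es.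
    exact: m_linear_l.
  have -> : circle L p = circle L y by apply/eqP; rewrite eq_circle Es.
  by rewrite m_coefC m_linear_l m_coefC.
have pp u : conn L u p = conn L' u p.
  by rewrite Es E's; apply: (out_joins eqE eqE' J).
have Jx u : conn L u p -> ~~ joins (conn L) x y x u.
  have [_ _ Jt] := joins_equiv x y eqE.
  by move=> up; apply: contra Jp => xu; apply: Jt xu _; apply: sub_joins.
have xp : conn L x p = false.
  by apply: contraNF Jp => xp; apply: sub_joins.
have yp : conn L y p = false.
  by apply: contraNF Jp => yp; rewrite (joinsx x y eqE) yp orbT.
have -> : local_coef L L' x y (circle L p |: S)%SET T = local_coef L L' x y S T.
  by rewrite /local_coef !pS xp yp.
have -> : local_coef L L' x y S (T :\ circle L' p)%SET = local_coef L L' x y S T.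
  by rewrite /local_coef !pT -!pp xp yp.
suff e : ~~ (circle L p \in S) && agree L L' x y (circle L p |: S)%SET T =
    (circle L' p \in T) && agree L L' x y S (T :\ circle L' p)%SET.
  by move: e; case: (circle L p \in S); case: (circle L' p \in T) => /= e; rewrite -?e ?e.
apply/andP/andP => [[pnS /forallP ag]|[pT' /forallP ag]].
  have := ag p; rewrite (negPf Jp) /= pS Er /= eq_sym eqb_id => pT'; split=> //.
  apply/forallP => u; have := ag u; rewrite pS pT -pp.
  case: (boolP (conn L u p)) => //= up _.
  have -> : circle L u = circle L p by apply/eqP; rewrite eq_circle.
  by rewrite (negPf pnS) eqxx orbT.
have := ag p; rewrite (negPf Jp) /= pT E'r /= eqbF_neg => pnS; split=> //.
apply/forallP => u; have := ag u; rewrite pS pT -pp.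
case: (boolP (conn L u p)) => //= up _.
have -> : circle L' u = circle L' p by apply/eqP; rewrite eq_circle -pp.
by rewrite pT' eqxx orbT.
Qed.

End Flip.

(** * Module structure over the darts *)

Section Squares.
Context (D : diagram).
Implicit Types (L S T U : {set {set dart D}}) (x y u v p q : dart D).
Implicit Types (F : {set {set dart D}} -> Rc).
Implicit Types (M N : {set {set dart D}} -> {set {set dart D}} -> Rc).

(** The basis vector with all circles labelled 1. *)
Definition vacuum S : Rc := (S == finset.set0)%:R.

(** Multiplication by Delta(1), placed on the circles of x and y. *)
Definition mulDelta L x y F S : Rc :=
  mulX L x F S + mulX L y F S + 'X * mulX L x (mulX L y F) S.

Lemma subsetD1l S T c : S \subset T -> (S :\ c)%SET \subset T.
Proof. exact: (fintype.subset_trans (subsetDl _ _)). Qed.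

Lemma eq_mulX L p F F' U : (forall S, S \subset U -> F S = F' S) ->
  mulX L p F U = mulX L p F' U.
Proof. by move=> eF; rewrite /mulX; case: ifP => // _; apply/eF/subsetDl. Qed.

Lemma eq_mulDelta L x y F F' U : (forall S, S \subset U -> F S = F' S) ->
  mulDelta L x y F U = mulDelta L x y F' U.
Proof.
move=> eF; rewrite /mulDelta !(@eq_mulX _ _ F F') //.
congr (_ + _ * _); apply: eq_mulX => S SU; apply: eq_mulX => S' S'S.
by apply: eF; apply: fintype.subset_trans SU.
Qed.

Lemma mulXC L p q F : mulX L p (mulX L q F) =1 mulX L q (mulX L p F).
Proof.
move=> U; rewrite /mulX !inE eq_sym setDDl setUC -setDDl.
by case: (circle L p \in U); case: (circle L q \in U); rewrite ?andbT ?andbF ?if_same.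
Qed.

Lemma mulXD L p F F' U : mulX L p (fun S => F S + F' S) U = mulX L p F U + mulX L p F' U.
Proof. by rewrite /mulX; case: ifP; rewrite ?addr0. Qed.

Lemma mulXZ L p (c : Rc) F U : mulX L p (fun S => c * F S) U = c * mulX L p F U.
Proof. by rewrite /mulX; case: ifP; rewrite ?mulr0. Qed.

Lemma mulX_Delta L p x y F : mulX L p (mulDelta L x y F) =1 mulDelta L x y (mulX L p F).
Proof.
move=> U; rewrite {1}/mulDelta !mulXD mulXZ /mulDelta; congr (_ + _ + _ * _); try exact: mulXC.
by rewrite mulXC; apply: eq_mulX => S _; apply: mulXC.
Qed.

Lemma mulDeltaC L x y u v F :
  mulDelta L x y (mulDelta L u v F) =1 mulDelta L u v (mulDelta L x y F).
Proof.
move=> U; rewrite {1}/mulDelta !mulX_Delta.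
have -> : mulX L x (mulX L y (mulDelta L u v F)) U =
    mulDelta L u v (mulX L x (mulX L y F)) U.
  by rewrite -mulX_Delta; apply: eq_mulX => S _; apply: mulX_Delta.
rewrite [in RHS]/mulDelta ![mulX _ _ (mulDelta _ _ _ _) _]mulXD !mulXZ.
have -> : mulX L u (mulX L v (mulDelta L x y F)) U =
    mulX L u (mulX L v (mulX L x F)) U + mulX L u (mulX L v (mulX L y F)) U
    + 'X * mulX L u (mulX L v (mulX L x (mulX L y F))) U.
  rewrite (@eq_mulX _ _ _ (fun S => mulX L v (mulX L x F) S + mulX L v (mulX L y F) S
    + 'X * mulX L v (mulX L x (mulX L y F)) S)) ?mulXD ?mulXZ // => S _.
  by rewrite !mulXD mulXZ.
by rewrite /mulDelta !mulXD; ring.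
Qed.

Lemma eq_mulDelta_circles L x y u v F :
  circle L x = circle L u -> circle L y = circle L v ->
  mulDelta L x y F =1 mulDelta L u v F.
Proof. by move=> xu yv U; rewrite /mulDelta /mulX xu yv. Qed.

Lemma mulDelta_sym L x y F : mulDelta L x y F =1 mulDelta L y x F.
Proof.
move=> U; rewrite /mulDelta mulXC; congr (_ + _); exact: addrC.
Qed.

Definition act L F M U : Rc := \sum_(T : {set {set dart D}} | T \subset circles L) F T * M T U.

(** The labellings containing the circle of p are those not containing it with
    that circle added; this transports the multiplication from the source to the
    target. *)
Lemma act_mulX L L' M p F U : equivariant L L' M -> U \subset circles L' ->
  act L (mulX L p F) M U = mulX L' p (act L F M) U.
Proof.
move=> eqM UL'; set c := circle L p.
have cL : c \in circles L by apply: mem_circles.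
transitivity (\sum_(T : {set {set dart D}} | (T \subset circles L) && (c \in T)) F (T :\ c)%SET * M T U).
  rewrite /act big_mkcondr; apply: eq_bigr => T _.
  by rewrite /mulX -/c; case: ifP; rewrite ?mul0r.
rewrite (reindex_onto (fun T => c |: T)%SET (fun T => T :\ c)%SET) /=; last first.
  by move=> T /andP[_ cT]; rewrite setD1K.
transitivity (\sum_(T : {set {set dart D}} | T \subset circles L)
    F T * (if c \in T then 0 else M (c |: T)%SET U)).
  rewrite [RHS](bigID (fun T : {set {set dart D}} => c \in T)) /=.
  rewrite [X in _ = X + _]big1 => [|T /andP[_ ->]]; last by rewrite mulr0.
  rewrite add0r; apply: eq_big => [T|T /andP[_ /eqP e]]; last first.
    have cT : c \notin T by rewrite -e setD11.
    by rewrite e (negPf cT).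
  rewrite subUset sub1set cL setU11 andbT /=; congr (_ && _).
  by apply/eqP/idP => [<-|cT]; [rewrite setD11 | rewrite setU1K].
rewrite /mulX /act; case: ifPn => pU.
  by apply: eq_bigr => T TL; rewrite eqM // /mulX pU.
by rewrite big1 // => T TL; rewrite eqM // /mulX (negPf pU) mulr0.
Qed.

Lemma act_mulDelta L L' M x y F U : equivariant L L' M -> U \subset circles L' ->
  act L (mulDelta L x y F) M U = mulDelta L' x y (act L F M) U.
Proof.
move=> eqM UL'.
rewrite /mulDelta -!(act_mulX _ _ eqM UL').
rewrite -(@eq_mulX _ _ (act L (mulX L y F) M)); last first.
  by move=> S SU; apply: act_mulX eqM (fintype.subset_trans SU UL').
rewrite -(act_mulX _ _ eqM UL') /act mulr_sumr -!big_split /=.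
by apply: eq_bigr => T _; rewrite !mulrDl mulrA.
Qed.

Lemma equivariant_comp L L' L'' M N : equivariant L L' M -> equivariant L' L'' N ->
  equivariant L L'' (fun S => act L' (M S) N).
Proof.
move=> eqM eqN p S U SL UL''.
rewrite -(act_mulX _ _ eqN UL'') /act; case: ifPn => pS.
  rewrite big1 // => T TL'.
  by rewrite -eqM // pS mul0r.
by apply: eq_bigr => T TL'; rewrite -eqM // (negPf pS).
Qed.

(** The module of a state is generated by the vacuum under the operators mulX, so
    an equivariant map is determined by its value there. *)
Lemma equivariant_eq L L' M N : equivariant L L' M -> equivariant L L' N ->
  (forall T, T \subset circles L' -> M finset.set0 T = N finset.set0 T) ->
  forall S T, S \subset circles L -> T \subset circles L' -> M S T = N S T.
Proof.
move=> eqM eqN e0 S; have [n] := ubnP #|S|; elim: n S => // n IHn S le_n T SL TL'.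
have [->|/set0Pn[c cS]] := eqVneq S finset.set0; first exact: e0.
have /circlesP[p cp] := fintype.subsetP SL c cS.
have SL1 := subsetD1l c SL.
have n1 : (#|(S :\ c)%SET| < n)%N by move: le_n; rewrite (cardsD1 c) cS.
have := eqM p _ _ SL1 TL'; have := eqN p _ _ SL1 TL'.
rewrite -cp setD11 setD1K // => -> ->.
by rewrite /mulX; case: ifP => // _; apply: IHn => //; apply: subsetD1l.
Qed.

Lemma act_vacuum L M U : act L vacuum M U = M finset.set0 U.
Proof.
rewrite /act (bigD1 finset.set0) ?sub0set //= /vacuum eqxx mul1r big1 ?addr0 //.
by move=> T /andP[_ /negPf->]; rewrite mul0r.
Qed.

(** The labels away from x and y have to agree, so T contains at most the circles
    through x and y; what remains are the values of m and Delta at 1. *)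
Lemma xi_vacuum L x y T : let L' := (vertex x |: L)%SET in flips L L' x y ->
  T \subset circles L' ->
  xi_coef (vertex x) L finset.set0 T =
    if conn L x y then mulDelta L' x y vacuum T else vacuum T.
Proof.
move=> L' fl TL'; rewrite (xi_coefE fl) ?sub0set // -/L'; have [h J] := fl.
have eqE' := conn_equiv L'.
have out : agree L L' x y finset.set0 T = (T \subset [set circle L' x; circle L' y])%SET.
  apply/forallP/fintype.subsetP => [ag c cT|sT u].
    have /circlesP[u cu] := fintype.subsetP TL' c cT.
    have := ag u; rewrite !inE -cu cT orbF -J (joinsx x y eqE') cu !eq_circle.
    by rewrite ![conn L' u _]conn_sym.
  rewrite inE /= eq_sym eqbF_neg -J (joinsx x y eqE') ![conn L' _ u]conn_sym -!eq_circle.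
  by case: (boolP (circle L' u \in T)) => [/sT|]; rewrite ?orbT // !inE orbF.
rewrite out /local_coef !inE.
have -> : vacuum T = (T \subset [set circle L' x; circle L' y]%SET)%:R
    * (~~ (circle L' x \in T) && ~~ (circle L' y \in T))%:R.
  rewrite /vacuum -natrM mulnb; congr (_%:R); congr nat_of_bool.
  apply/eqP/and3P => [->|[sT xT yT]]; first by rewrite sub0set !inE.
  apply/setP => c; rewrite [RHS]inE; apply/negP => cT.
  have := fintype.subsetP sT c cT; rewrite !inE => /orP[]/eqP e.
    by rewrite -e cT in xT.
  by rewrite -e cT in yT.
case: ifPn => [sT|nsT]; last first.
  rewrite mul0r; case: ifP => // cxy; apply/esym.
  have n1 c : c \in [set circle L' x; circle L' y]%SET -> (T :\ c == finset.set0)%SET = false.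
    move=> cxy'; apply: contraNF nsT; rewrite setD_eq0 => /fintype.subset_trans -> //.
    by rewrite sub1set.
  have n2 : ((T :\ circle L' x) :\ circle L' y == finset.set0)%SET = false.
    by apply: contraNF nsT; rewrite setDDl setD_eq0.
  by rewrite /mulDelta /mulX /vacuum !n1 ?n2 ?inE ?eqxx ?orbT // !if_same mulr0 !addr0.
rewrite mul1r; case: ifPn => cxy; last first.
  have -> : circle L' y = circle L' x by apply/eqP; rewrite eq_circle conn_sym h.
  by rewrite andbb /m_coef; case: (_ \in T).
have xy' : (circle L' y == circle L' x) = false by rewrite eq_circle conn_sym h cxy.
have Tx : (T :\ circle L' x == finset.set0)%SET = ~~ (circle L' y \in T).
  rewrite setD_eq0; apply/idP/idP => [sx|yT].
    by apply: contraFN xy' => /(fintype.subsetP sx); rewrite inE.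
  apply/fintype.subsetP => c cT; have := fintype.subsetP sT c cT.
  by rewrite !inE => /orP[//|/eqP cy]; rewrite -cy cT in yT.
have Ty : (T :\ circle L' y == finset.set0)%SET = ~~ (circle L' x \in T).
  rewrite setD_eq0; apply/idP/idP => [sx|yT].
    by apply: contraFN xy' => /(fintype.subsetP sx); rewrite inE eq_sym.
  apply/fintype.subsetP => c cT; have := fintype.subsetP sT c cT.
  by rewrite !inE => /orP[/eqP cx|//]; rewrite -cx cT in yT.
have Txy : ((T :\ circle L' x) :\ circle L' y == finset.set0)%SET.
  by rewrite setDDl setD_eq0.
rewrite /mulDelta /mulX /vacuum !inE xy' Tx Ty Txy /=.
by case: (circle L' x \in T); case: (circle L' y \in T); rewrite ?mulr0 ?mulr1 ?addr0 ?add0r.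
Qed.

End Squares.

(** * Commutation of the squares of the cube *)

Section Anticommute.
Context (D : diagram).
Implicit Types (L S T U : {set {set dart D}}) (x y u v p q : dart D).

Lemma joins_id (E : rel (dart D)) x y : is_equiv E -> E x y -> joins E x y =2 E.
Proof.
move=> eqE Exy u v; apply/idP/idP; last exact: sub_joins.
exact: (joins_sub eqE).
Qed.

Lemma card_flips L L' x y : flips L L' x y ->
  (#|circles L'| + ~~ conn L x y = #|circles L| + conn L x y)%N.
Proof.
move=> [h J]; rewrite !card_circles.
have [cxy|cxy] := boolP (conn L x y) => /=.
  rewrite (@n_comp_joins _ (step (arcp D) (smoothp L')) (step (arcp D) (smoothp L)) x y).
  - by rewrite -/(conn L' x y) h cxy addn0.
  - exact: step_sym.
  - exact: step_sym.
  by move=> u v; rewrite -/(conn L u v) -(joins_id (conn_equiv L) cxy) -J.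
rewrite (@n_comp_joins _ (step (arcp D) (smoothp L)) (step (arcp D) (smoothp L')) x y).
- by rewrite -/(conn L x y) cxy addn0.
- exact: step_sym.
- exact: step_sym.
have cxy' : conn L' x y by rewrite h.
by move=> u v; rewrite -/(conn L' u v) -(joins_id (conn_equiv L') cxy') J.
Qed.

(** Along both sides of a square the number of circles changes by the same
    amount, so the numbers of splits along both sides agree. *)
Lemma parity_square (n nx nu m : nat) (A B C E : bool) :
  (nx + ~~ A = n + A)%N -> (m + ~~ B = nx + B)%N ->
  (nu + ~~ C = n + C)%N -> (m + ~~ E = nu + E)%N -> (A + B = C + E)%N.
Proof. by case: A; case: B; case: C; case: E => /=; lia. Qed.

(** Only the identification of x and y can connect u and v, so that one of these
    lies on the circle of x and the other on that of y. *)
Lemma mulDelta_joins L x y u v F : joins (conn L) x y u v -> ~~ conn L u v ->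
  mulDelta L x y F =1 mulDelta L u v F.
Proof.
move=> + nuv U; rewrite /joins (negPf nuv) /= => /orP[]/andP[ux yv].
  by apply: eq_mulDelta_circles; apply/eqP; rewrite eq_circle // conn_sym.
rewrite mulDelta_sym.
by apply: eq_mulDelta_circles; apply/eqP; rewrite eq_circle // conn_sym.
Qed.

(** A, B tell whether the surgeries at x, then u are splits, and C, E the same for
    u, then x. When the same surgeries are splits in both orders, both sides are
    equal by commutativity; the remaining cases compare Delta(1) at x with Delta(1)
    at u. *)
Lemma mulDelta_square L x y u v F (A B C E : bool) U :
  (A + B = C + E)%N ->
  (A -> ~~ E -> mulDelta L x y F =1 mulDelta L u v F) ->
  (~~ A -> E -> mulDelta L x y F =1 mulDelta L u v F) ->
  (if A then mulDelta L x y (fun S => if B then mulDelta L u v F S else F S) U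
   else if B then mulDelta L u v F U else F U) =
  (if C then mulDelta L u v (fun S => if E then mulDelta L x y F S else F S) U
   else if E then mulDelta L x y F U else F U).
Proof.
case: A; case: B; case: C; case: E => AB rel rel'.
all: try by exfalso; move: AB.
- exact: mulDeltaC.
- exact: rel.
- by [].
- by [].
- by apply/esym/rel'.
- by [].
Qed.

(** Both composites are equivariant, so it suffices to compare them on the
    vacuum, where they multiply it by Delta(1) once for each split. The cases that
    are not immediate are those in which x is split in one order and u in the
    other; then x and u touch the same circles at the end. *)
Lemma xi_square (o : pred (dart D)) L x u S U : alternating o ->
  is_double x -> o x -> is_double u -> o u -> vertex x != vertex u ->
  vertex x \notin L -> vertex u \notin L ->
  S \subset circles L -> U \subset circles (vertex u |: (vertex x |: L))%SET ->
  \sum_(T : {set {set dart D}} | T \subset circles (vertex x |: L)%SET)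
     xi_coef (vertex x) L S T * xi_coef (vertex u) (vertex x |: L)%SET T U =
  \sum_(T : {set {set dart D}} | T \subset circles (vertex u |: L)%SET)
     xi_coef (vertex u) L S T * xi_coef (vertex x) (vertex u |: L)%SET T U.
Proof.
move=> altD xd ox ud ou xu xL uL SL.
set a := vertex x; set b := vertex u; set La := (a |: L)%SET; set Lb := (b |: L)%SET.
set L2 := (b |: La)%SET => UL2.
have L2E : (a |: Lb)%SET = L2 by rewrite /La /Lb setUCA.
set y := rot (rot x); set v := rot (rot u).
have fxL : flips L La x y by apply: surgery.
have fuL : flips L Lb u v by apply: surgery.
have fuLa : flips La L2 u v.
  by apply: surgery altD ud ou _; rewrite !inE negb_or eq_sym xu.
have fxLb : flips Lb L2 x y.
  by rewrite -L2E; apply: surgery altD xd ox _; rewrite !inE negb_or xu.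
have count : (conn L x y + conn La u v = conn L u v + conn Lb x y)%N.
  exact: (parity_square (card_flips fxL) (card_flips fuLa) (card_flips fuL) (card_flips fxLb)).
change (act La (xi_coef a L S) (xi_coef b La) U = act Lb (xi_coef b L S) (xi_coef a Lb) U).
have eqxLb : equivariant Lb L2 (xi_coef a Lb).
  by rewrite -L2E; apply: xi_equivariant; rewrite -/a L2E; exact: fxLb.
have equLa : equivariant La L2 (xi_coef b La) by apply: xi_equivariant fuLa.
have eqxL : equivariant L La (xi_coef a L) by apply: xi_equivariant fxL.
have equL : equivariant L Lb (xi_coef b L) by apply: xi_equivariant fuL.
pose M S := act La (xi_coef a L S) (xi_coef b La).
pose N S := act Lb (xi_coef b L S) (xi_coef a Lb).
have eqM : equivariant L L2 M by exact: (equivariant_comp eqxL equLa).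
have eqN : equivariant L L2 N by exact: (equivariant_comp equL eqxLb).
rewrite -/(M S) -/(N S).
apply: (equivariant_eq eqM eqN) SL UL2.
move=> {}U UL2; rewrite /M /N.
have -> : act La (xi_coef a L finset.set0) (xi_coef b La) U =
    if conn L x y then mulDelta L2 x y (xi_coef b La finset.set0) U
    else xi_coef b La finset.set0 U.
  transitivity (act La (if conn L x y then mulDelta La x y (@vacuum D) else @vacuum D)
    (xi_coef b La) U).
    by apply: eq_bigr => T TL; rewrite (xi_vacuum fxL) //; case: ifP.
  case: ifP => _; last exact: act_vacuum.
  rewrite (act_mulDelta _ _ _ equLa) //; apply: eq_mulDelta => T _; exact: act_vacuum.
have -> : act Lb (xi_coef b L finset.set0) (xi_coef a Lb) U =
    if conn L u v then mulDelta L2 u v (xi_coef a Lb finset.set0) U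
    else xi_coef a Lb finset.set0 U.
  transitivity (act Lb (if conn L u v then mulDelta Lb u v (@vacuum D) else @vacuum D)
    (xi_coef a Lb) U).
    by apply: eq_bigr => T TL; rewrite (xi_vacuum fuL) //; case: ifP.
  case: ifP => _; last exact: act_vacuum.
  rewrite (act_mulDelta _ _ _ eqxLb) //; apply: eq_mulDelta => T _; exact: act_vacuum.
have vu T : T \subset U -> xi_coef b La finset.set0 T =
    if conn La u v then mulDelta L2 u v (@vacuum D) T else vacuum T.
  by move=> TU; apply: xi_vacuum fuLa (fintype.subset_trans TU UL2).
have vx T : T \subset U -> xi_coef a Lb finset.set0 T =
    if conn Lb x y then mulDelta L2 x y (@vacuum D) T else vacuum T.
  move=> TU; rewrite -L2E; apply: xi_vacuum; rewrite -/a L2E //.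
  exact: fintype.subset_trans TU UL2.
rewrite (eq_mulDelta _ _ _ vu) (eq_mulDelta _ _ _ vx) vu ?vx; try exact: fintype.subxx.
have [hxL JxL] := fxL; have [huL JuL] := fuL.
have [hxLb JxLb] := fxLb; have [huLa JuLa] := fuLa.
clear vu vx eqM eqN M N eqxLb equLa eqxL equL fxL fuL fxLb fuLa.
(* First case: in either order a split is followed by a merge, and all four darts end on
   one circle. Second case: in either order a merge is followed by a split, and the two
   circles at x are in the end those at u. *)
apply: mulDelta_square (count) _ _ => [cx /negbTE cx'|/negbTE cx cx'].
  have cxL2 : conn L2 x y by rewrite hxLb cx'.
  have Lb_L2 p q : conn Lb p q -> conn L2 p q.
    by move=> pq; rewrite -(joins_id (conn_equiv L2) cxL2) JxLb; apply: sub_joins.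
  have : joins (conn Lb) u v x y by rewrite JuL; apply: sub_joins.
  rewrite /joins cx' => /orP[//|] /orP[]/andP[xu' yv'].
    by apply: eq_mulDelta_circles; apply/eqP; rewrite eq_circle; apply: Lb_L2; rewrite // conn_sym.
  move=> V; rewrite mulDelta_sym; move: V.
  by apply: eq_mulDelta_circles; apply/eqP; rewrite eq_circle; apply: Lb_L2; rewrite // conn_sym.
have [cu cu'] : conn L u v = false /\ conn La u v.
  by have := count; rewrite cx cx'; case: (conn L u v); case: (conn La u v).
apply: mulDelta_joins; last by rewrite huLa cu'.
by rewrite JxLb; apply: sub_joins; rewrite huL cu.
Qed.
End Anticommute.

(** * The square of the differential *)

Lemma sum_sig (R : nmodType) (I : finType) (P : pred I) (F : I -> R) :
  \sum_(t : {x | P x}) F (val t) = \sum_(x | P x) F x.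
Proof.
rewrite (reindex_omap (val : {x | P x} -> I) insub) => [|x Px]; last by rewrite insubT.
by apply: eq_bigl => t; rewrite (valP t) valK eqxx.
Qed.

Section SquareZero.
Context (D : diagram) (plD : planar D).
Local Notation pt := {set dart D}.
Context (le : rel pt) (leP : double_point_order le).
Implicit Types (a b : pt) (L S U : {set pt}) (s t u : {set pt} * {set pt}).

(** The sign of the edge of the cube that adds a to L. *)
Definition sgn a L : Rc := (-1) ^+ #|[set b in L | ~~ le b a]%SET|.

Lemma sgn_setU1 a b L : a \notin L -> sgn b (a |: L)%SET = (-1) ^+ (~~ le a b) * sgn b L.
Proof.
move=> aL; rewrite /sgn -exprD; congr (_ ^+ _).
rewrite (cardsD1 a) !inE eqxx /=; congr (_ + _)%N.
apply: eq_card => c; rewrite !inE.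
by have [->|] := eqVneq c a; rewrite ?(negPf aL).
Qed.

Lemma sgn_anti a b : a \in double_points D -> b \in double_points D -> a != b ->
  (-1) ^+ (~~ le a b) = - (-1) ^+ (~~ le b a) :> Rc.
Proof.
have [anti _ tot] := leP => aD bD ab.
have := tot a b aD bD; have := anti a b aD bD.
case: (le a b); case: (le b a) => //= e _.
- by rewrite e ?eqxx in ab.
- by rewrite expr0 expr1 opprK.
Qed.

Lemma double_point_out (o : pred (dart D)) a : alternating o -> a \in double_points D ->
  exists x, [/\ a = vertex x, is_double x & o x].
Proof.
move=> altD /imsetP[x]; rewrite inE => xd ->.
have [ox|nox] := boolP (o x); first by exists x.
exists (rot x); rewrite vertex_rotE double_rot.
by split=> //; case: (altD x) => _ ->.
Qed.

Lemma xi_square_points a b L S U :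
  a \in double_points D -> b \in double_points D -> a != b ->
  a \notin L -> b \notin L -> S \subset circles L ->
  U \subset circles (b |: (a |: L))%SET ->
  \sum_(T : {set pt} | T \subset circles (a |: L)%SET)
     xi_coef a L S T * xi_coef b (a |: L)%SET T U =
  \sum_(T : {set pt} | T \subset circles (b |: L)%SET)
     xi_coef b L S T * xi_coef a (b |: L)%SET T U.
Proof.
have [o altD] := planar_alternating plD.
move=> /(double_point_out altD)[x [-> xd ox]] /(double_point_out altD)[u [-> ud ou]].
exact: xi_square altD xd ox ud ou.
Qed.

(** The sum runs over ordered pairs of added points; exchanging them changes the
    sign and nothing else. *)
Lemma d_coef_sq s u (k : int) :
  s.1 \subset double_points D -> s.2 \subset circles s.1 ->
  #|s.1|%:Z + 1 = k -> u.2 \subset circles u.1 ->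
  \sum_(t : generator D k) d_coef le s (val t) * d_coef le (val t) u = 0.
Proof.
case: s => L S; case: u => N U /= LD SL Lk UN.
pose W := double_points D.
pose Xi a b := \sum_(T : {set pt} | T \subset circles (a |: L)%SET)
     xi_coef a L S T * xi_coef b (a |: L)%SET T U.
pose G a b : Rc := if (a != b) && (N == b |: (a |: L))%SET
  then sgn a L * sgn b (a |: L)%SET * Xi a b else 0.
(* G a b is the contribution of adding first a and then b. *)
have Ganti a b : a \in (W :\: L)%SET -> b \in (W :\: L)%SET -> G a b = - G b a.
  rewrite !inE => /andP[aL aD] /andP[bL bD]; rewrite /G eq_sym setUCA.
  have [->|ab] := eqVneq b a; first by rewrite oppr0.
  have [NE|_] := eqVneq N (a |: (b |: L))%SET; last by rewrite oppr0.
  rewrite /= !sgn_setU1 // (@sgn_anti a b) // 1?eq_sym //.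
  have -> : Xi a b = Xi b a by apply: xi_square_points; rewrite // 1?eq_sym // setUCA -NE.
  by ring.
have -> : \sum_(t : generator D k) d_coef le (L, S) (val t) * d_coef le (val t) (N, U) =
    \sum_(a in (W :\: L)%SET) \sum_(b in (W :\: L)%SET) G a b.
  rewrite (sum_sig _ (fun t => d_coef le (L, S) t * d_coef le t (N, U))) /=.
  under eq_bigr => t _ do rewrite {1}/d_coef mulr_suml.
  rewrite (exchange_big_dep (fun a => a \in (W :\: L)%SET)) /=; last first.
    by move=> t a _ /andP[].
  apply: eq_bigr => a aW.
  have [aL aD] : a \notin L /\ a \in W by move: aW; rewrite inE => /andP[].
  rewrite (reindex_onto (fun T => ((a |: L)%SET, T)) snd) /=; last first.
    by move=> [M T] /= /andP[_ /andP[_ /eqP ->]].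
  transitivity (\sum_(T : {set pt} | T \subset circles (a |: L)%SET)
      \sum_(b in (W :\: (a |: L))%SET | N == (b |: (a |: L))%SET)
        sgn a L * sgn b (a |: L)%SET * (xi_coef a L S T * xi_coef b (a |: L)%SET T U)).
    apply: eq_big => [T|T _].
      rewrite !eqxx aW !andbT subUset sub1set aD LD cardsU1 aL -Lk /=.
      by rewrite PoszD addrC eqxx.
    rewrite /d_coef /= mulr_sumr; apply: eq_bigr => b _.
    by rewrite -/(sgn a L) -/(sgn b (a |: L)%SET) mulrACA.
  rewrite (exchange_big_dep (fun b => (b \in (W :\: (a |: L))%SET) && (N == (b |: (a |: L))%SET))) //=.
  rewrite big_mkcond [RHS]big_mkcond; apply: eq_bigr => b _.
  rewrite -/(Xi a b) /G !inE negb_or [a == b]eq_sym.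
  case: (b == a) => //=; rewrite ?if_same //.
  case: (b \in L) => //=; case: (b \in W) => //=.
  case: (N == (b |: (a |: L))%SET) => //=.
  by rewrite -mulr_sumr; under eq_bigl do rewrite andbT.
have e : \sum_(a in (W :\: L)%SET) \sum_(b in (W :\: L)%SET) G a b
   = - \sum_(a in (W :\: L)%SET) \sum_(b in (W :\: L)%SET) G a b.
  rewrite [LHS]exchange_big -sumrN; apply: eq_bigr => a aW.
  by rewrite -sumrN; apply: eq_bigr => b bW; apply: Ganti.
apply/eqP; move/eqP: e; rewrite -addr_eq0 -mulr2n -mulr_natl mulf_eq0.
by rewrite -polyC_natr polyC_eq0 => /orP[].
Qed.

End SquareZero.

(** * Degrees *)

Section Grading.
Context (D : diagram).
Local Notation pt := {set dart D}.
Implicit Types (a b : pt) (L S T : {set pt}) (s t u : {set pt} * {set pt}).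

Lemma m_coef_deg (x y z : bool) n : (m_coef x y z)`_n != 0 ->
  label_deg x + label_deg y = n%:Z *+ 2 + label_deg z + 1.
Proof.
case: x; case: y; case: z; rewrite /m_coef /= ?coef0 ?eqxx //;
  rewrite coef1; case: n => //=.
Qed.

Lemma Delta_coef_deg (x y z : bool) n : (Delta_coef x y z)`_n != 0 ->
  label_deg x = n%:Z *+ 2 + (label_deg y + label_deg z) + 1.
Proof.
case: x; case: y; case: z; rewrite /Delta_coef /= ?coef0 ?eqxx //;
  rewrite ?coef1 ?coefX; case: n => [|[]] //=.
Qed.

Lemma xi_coef_deg a L S T n : a \notin L -> (xi_coef a L S T)`_n != 0 ->
  n%:Z *+ 2 + gen_deg ((a |: L)%SET, T) = gen_deg (L, S).
Proof.
move=> aL; rewrite /xi_coef; set K := circles L; set K' := circles _.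
case: ifP => [/eqP ST|_]; last by rewrite coef0 eqxx.
have common : \sum_(C in (K :&: K')%SET) label_deg (C \in S)
    = \sum_(C in (K' :&: K)%SET) label_deg (C \in T).
  rewrite [(K' :&: K)%SET]setIC; apply: eq_bigr => C; rewrite inE => /andP[CK CK'].
  by move/setP/(_ C): ST; rewrite !inE CK CK' !andbT => ->.
have rest m : \sum_(C in (K :\: K')%SET) label_deg (C \in S) =
    m + \sum_(C in (K' :\: K)%SET) label_deg (C \in T) + 1 ->
    m + gen_deg ((a |: L)%SET, T) = gen_deg (L, S).
  rewrite /gen_deg /= -/K -/K' => e.
  rewrite [in RHS](big_setID K') /= [in LHS](big_setID K) /= common e cardsU1 aL PoszD.
  by rewrite -[Posz true]/(1 : int); ring.
move=> nz; apply: rest; rewrite -[in LHS]big_enum -[in RHS]big_enum /=.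
move: nz; case: (enum (K :\: K')%SET) => [|C [|C' [|? ?]]]; rewrite ?coef0 ?eqxx //.
  case: (enum (K' :\: K)%SET) => [|C1 [|C2 [|? ?]]]; rewrite ?coef0 ?eqxx // => /Delta_coef_deg.
  by rewrite !big_cons !big_nil !addr0.
case: (enum (K' :\: K)%SET) => [|C1 [|? ?]]; rewrite ?coef0 ?eqxx // => /m_coef_deg.
by rewrite !big_cons !big_nil !addr0.
Qed.

(** Both m and Delta have degree -1, which the term |L| of gen_deg compensates; a
    monomial c^n counts for 2n. *)
Lemma d_coef_deg (le : rel pt) s t n : (d_coef le s t)`_n != 0 ->
  n%:Z *+ 2 + gen_deg t = gen_deg s.
Proof.
case: s => L S; case: t => M T; rewrite /d_coef coef_sum /=.
apply: contraNeq => ne; apply/eqP; apply: big1 => a /andP[]; rewrite inE => /andP[aL _] /eqP ME.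
apply/eqP; rewrite -signr_odd; apply: contraNT ne; rewrite ME => nz.
apply/eqP; apply: xi_coef_deg => //; apply: contraNneq nz => e.
by case: (odd _); rewrite ?expr0 ?expr1 ?mul1r ?mulN1r ?coefN e ?oppr0.
Qed.

End Grading.

(** * Tensoring an abelian group with the rationals *)

Section TensorQ.

Lemma ratQ_mulrn_inj (W : lmodType rat) n : (0 < n)%N -> injective (fun w : W => w *+ n).
Proof.
move=> n0 u v /= e; have nz : (n%:R : rat) != 0 by rewrite pnatr_eq0 -lt0n.
by rewrite -[u](scalerK nz) -[v](scalerK nz) !scaler_nat e.
Qed.

Context (M : zmodType) (V : vectType rat) (i : {additive M -> V}).
Hypothesis i_tors : forall m, i m = 0 -> exists2 n, (0 < n)%N & m *+ n = 0.
Hypothesis i_gen : forall v, exists n m, (0 < n)%N /\ v *+ n = i m.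

Section Extend.
Context (W : lmodType rat) (f : {additive M -> W}).

Lemma extension_wd n m n' m' v : (0 < n)%N -> (0 < n')%N ->
  v *+ n = i m -> v *+ n' = i m' -> (n%:R : rat)^-1 *: f m = (n'%:R : rat)^-1 *: f m'.
Proof.
move=> n0 n'0 e e'.
have nz : (n%:R : rat) != 0 by rewrite pnatr_eq0 -lt0n.
have nz' : (n'%:R : rat) != 0 by rewrite pnatr_eq0 -lt0n.
have [k k0] : exists2 k, (0 < k)%N & (m *+ n' - m' *+ n) *+ k = 0.
  by apply: i_tors; rewrite raddfB !(raddfMn i) -e -e' mulrnAC subrr.
move/(congr1 f); rewrite raddf0 (raddfMn f) => kf.
have : f (m *+ n' - m' *+ n) = 0 by apply: (ratQ_mulrn_inj k0); rewrite kf mul0rn.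
rewrite raddfB !(raddfMn f) => /eqP; rewrite subr_eq0 => /eqP ef.
by rewrite -[f m](scalerK nz') scaler_nat ef -scaler_nat !scalerA; congr (_ *: _); field; rewrite nz nz'.
Qed.

Definition witness v : nat * M :=
  sval (cid (P := fun nm : nat * M => (0 < nm.1)%N /\ v *+ nm.1 = i nm.2)
    (let: ex_intro n (ex_intro m h) := i_gen v in ex_intro _ (n, m) h)).

Lemma witnessP v : (0 < (witness v).1)%N /\ v *+ (witness v).1 = i (witness v).2.
Proof. by rewrite /witness; case: cid. Qed.

(** The only possible value at v of the linear map extending f. *)
Definition extension v : W := ((witness v).1%:R : rat)^-1 *: f (witness v).2.

Lemma extensionE n m v : (0 < n)%N -> v *+ n = i m ->
  extension v = (n%:R : rat)^-1 *: f m.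
Proof. by move=> n0 e; have [w0 we] := witnessP v; apply: extension_wd w0 n0 we e. Qed.

Lemma extension_linear : linear extension.
Proof.
move=> a u v; have [u0 ue] := witnessP u; have [v0 ve] := witnessP v.
set n := (witness u).1 in u0 ue; set n' := (witness v).1 in v0 ve.
set m := (witness u).2 in ue; set m' := (witness v).2 in ve.
(* With a = numq a / d, the multiple by d * n * n' of a *: u + v is in the image of i. *)
pose d := `|denq a|%N; have d0 : (0 < d)%N by rewrite absz_gt0 denq_eq0.
have dz : (d%:R : rat) != 0 by rewrite pnatr_eq0 -lt0n.
have nz : (n%:R : rat) != 0 by rewrite pnatr_eq0 -lt0n.
have nz' : (n'%:R : rat) != 0 by rewrite pnatr_eq0 -lt0n.
have aE : (numq a)%:~R = a * d%:R.
  rewrite -[in RHS](divq_num_den a) mulrAC -mulrA.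
  have -> : (d%:R : rat) = (denq a)%:~R by rewrite -[denq a](gez0_abs (denq_ge0 a)) -pmulrn.
  by rewrite divff ?mulr1 // intr_eq0 denq_eq0.
have e : (a *: u + v) *+ (d * n * n') = i ((m *~ numq a) *+ n' + m' *+ (d * n)).
  rewrite raddfD !(raddfMn i) (raddfMz i) -ue -ve mulrnDl; congr (_ + _); last first.
    by rewrite -!mulrnA mulnC.
  rewrite [in LHS]mulrnA; congr (_ *+ _).
  rewrite -[LHS]scaler_nat -[RHS]scaler_int -scaler_nat !scalerA; congr (_ *: _).
  by rewrite aE natrM; ring.
rewrite (extensionE _ e) ?muln_gt0 ?d0 ?u0 ?v0 // (extensionE u0 ue) (extensionE v0 ve).
rewrite raddfD !(raddfMn f) (raddfMz f) scalerDr; congr (_ + _).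
  rewrite -[f m *~ _]scaler_int -scaler_nat !scalerA; congr (_ *: _).
  by rewrite aE !natrM; field; rewrite dz nz nz'.
rewrite -scaler_nat !scalerA; congr (_ *: _).
by rewrite !natrM; field; rewrite dz nz nz'.
Qed.

Lemma extension_exists :
  exists2 g : {linear V -> W}, (forall x, g (i x) = f x) &
    forall h : {linear V -> W}, (forall x, h (i x) = f x) -> h =1 g.
Proof.
pose L := GRing.isLinear.Build rat V W _ extension extension_linear.
pose g : {linear V -> W} := HB.pack extension L.
exists g => [x|h hi v].
  by rewrite /= (@extensionE 1 x) // invr1 scale1r.
have [v0 ve] := witnessP v; apply: (ratQ_mulrn_inj v0).
have -> : h v *+ (witness v).1 = f (witness v).2 by rewrite -hi -ve raddfMn.
rewrite -[RHS]scaler_nat [g v]/(extension v) /extension scalerA.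
by rewrite mulfV ?scale1r // pnatr_eq0 -lt0n.
Qed.

End Extend.

(** A map to a rational vector space whose kernel is torsion and whose image
    spans up to denominators is the tensor product with the rationals. This avoids
    constructing the tensor product of the cohomology groups. *)
Lemma tensorQ_intro : is_tensorQ i.
Proof. by move=> W f; apply: extension_exists. Qed.

End TensorQ.

Lemma dim_le_tensorQ (M : zmodType) (V V' : vectType rat)
    (i : {additive M -> V}) (i' : {additive M -> V'}) :
  is_tensorQ i -> is_tensorQ i' -> (\dim {:V} <= \dim {:V'})%N.
Proof.
move=> ti ti'; have [g gi _] := ti _ i'; have [h hi _] := ti' _ i.
have [k _ ku] := ti _ i.
have hg v : h (g v) = v.
  have -> : h (g v) = k v by apply: (ku (h \o g)%FUN) => x /=; rewrite gi hi.
  by apply/esym/(ku idfun).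
have ker0 : (fullv :&: lker (linfun g) = 0)%VS.
  rewrite capfv; apply/eqP/lker0P => u v; rewrite !lfunE => e.
  by rewrite -[u]hg e hg.
by rewrite -(limg_dim_eq ker0) dimvS ?subvf.
Qed.

Lemma dimQ_eq (M : zmodType) (V : vectType rat) (i : {additive M -> V}) :
  is_tensorQ i -> dimQ M = \dim {:V}.
Proof.
move=> ti; rewrite /dimQ; case: xgetP => [n _ [V' [i' [ti' <-]]]|/(_ (\dim {:V}))[]].
  by apply/eqP; rewrite eqn_leq (dim_le_tensorQ ti ti') (dim_le_tensorQ ti' ti).
by exists V, i.
Qed.

Lemma common_denominator (I : finType) (w : I -> rat) :
  exists2 n, (0 < n)%N & exists z : I -> int, forall s, w s *+ n = (z s)%:~R.
Proof.
exists (\prod_s `|denq (w s)|%N)%N.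
  by apply: prodn_gt0 => s; rewrite absz_gt0 denq_eq0.
exists (fun s => numq (w s) * (\prod_(t | t != s) `|denq (w t)|%N)%N%:Z) => s.
rewrite (bigD1 s) //= mulrnA intrM -[_ *+ _ in LHS]mulr_natr; congr (_ * _).
rewrite numqE -mulr_natr; congr (_ * _).
by rewrite -[in RHS](gez0_abs (denq_ge0 (w s))) -pmulrn.
Qed.

(** * The rank of a graded piece of cohomology *)

Lemma piece_mulrn (M : gmodule) j (u : M) n : piece j u -> piece j (u *+ n).
Proof.
have [p0 pB] := @piece_closed M j => pu.
elim: n => [|n IHn]; first by rewrite mulr0n.
have -> : u *+ n.+1 = u - (0 - u *+ n) by rewrite sub0r opprK mulrS.
by apply: (pB _ _ pu); apply: (pB _ _ p0).
Qed.

Section CohomologyDimension.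
Context (C : gcomplex) (i j : int).
Let d0 := @diff C (i - 1) i.
Let d1 := @diff C i (i + 1).
Context (V0 V1 V2 : vectType rat).
Context (q0 : {additive cochain C (i - 1) -> V0}) (q1 : {additive cochain C i -> V1})
  (q2 : {additive cochain C (i + 1) -> V2}).
Context (f : {linear V0 -> V1}) (g : {linear V1 -> V2}).
Hypotheses (q1d : forall u, q1 (d0 u) = f (q0 u)) (q2d : forall u, q2 (d1 u) = g (q1 u)).
Hypotheses (piece_d0 : forall u, piece j u -> piece j (d0 u))
  (piece_d1 : forall u, piece j u -> piece j (d1 u)).
Hypotheses (q1_inj : forall u, piece j u -> q1 u = 0 -> u = 0)
  (q2_inj : forall u, piece j u -> q2 u = 0 -> u = 0).
Hypotheses (q0_gen : forall w, exists n u, [/\ (0 < n)%N, piece j u & w *+ n = q0 u])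
  (q1_gen : forall w, exists n u, [/\ (0 < n)%N, piece j u & w *+ n = q1 u]).
Hypothesis (dd : forall u, d1 (d0 u) = 0).

Let B := limg (linfun f).
Let Z := lker (linfun g).
Let phi := (\1 - projv B)%VF.
Let U := (phi @: Z)%VS.

Lemma boundaries_sub_cycles : (B <= Z)%VS.
Proof.
apply/subvP => _ /memv_imgP[w _ ->]; rewrite memv_ker !lfunE; apply/eqP.
have [n [u [n0 _ e]]] := q0_gen w; apply: (ratQ_mulrn_inj n0).
by rewrite -!linearMn e -q1d -q2d dd raddf0 mul0rn.
Qed.

(** phi is a model of the projection onto the quotient by the boundaries inside
    V1 itself. *)
Lemma lker_phi : lker phi = B.
Proof.
apply/vspaceP => v; rewrite memv_ker /phi add_lfunE opp_lfunE id_lfunE subr_eq0.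
by apply/eqP/idP => [->|vB]; [apply: memv_proj | rewrite projv_id].
Qed.

Let H := cohomology_module d0 d1.

Lemma coh_class_repr (x : H) : exists z : cocycle d1, coh_class d0 d1 z = x.
Proof. by exists (repr x); apply: coh_classK. Qed.

(** The rational class of x, computed from any representing cocycle, whether or
    not it is homogeneous. *)
Definition rational_class (x : H) : V1 := phi (q1 (val (repr x))).

Lemma rational_classE (z : cocycle d1) :
  rational_class (coh_class d0 d1 z) = phi (q1 (val z)).
Proof.
apply/eqP; rewrite -subr_eq0 /rational_class -2!raddfB -memv_ker lker_phi.
have /coh_classP : coh_class d0 d1 (repr (coh_class d0 d1 z)) = coh_class d0 d1 z.
  exact: coh_classK.
rewrite unfold_in => /asboolP[u e].
have -> : val (repr (coh_class d0 d1 z)) - val z = d0 u by rewrite e raddfB.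
by rewrite q1d; apply/memv_imgP; exists (q0 u); rewrite ?memvf ?lfunE.
Qed.

Lemma rational_classB : {morph rational_class : x y / x - y}.
Proof.
move=> x y; have [z <-] := coh_class_repr x; have [z' <-] := coh_class_repr y.
by rewrite -raddfB !rational_classE !raddfB.
Qed.

Lemma rational_class_sub (x : H) : rational_class x \in U.
Proof.
have [z <-] := coh_class_repr x; rewrite rational_classE memv_img // memv_ker lfunE.
have /eqP dz : is_cocycle d1 (val z) := valP z.
by rewrite -q2d dz raddf0.
Qed.

Definition rational_piece (x : homogeneous (cohomology C i) j) : subvs_of U :=
  vsproj U (rational_class (val x)).

Lemma rational_pieceB : {morph rational_piece : x y / x - y}.
Proof. by move=> x y; rewrite /rational_piece raddfB /= rational_classB raddfB. Qed.

Let iota : {additive homogeneous (cohomology C i) j -> subvs_of U} :=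
  HB.pack rational_piece
    (GRing.isZmodMorphism.Build _ _ rational_piece rational_pieceB).

(** Injectivity up to torsion: if a homogeneous cocycle is rationally the
    boundary of w, then a multiple of w comes from a homogeneous integral cochain,
    whose boundary has the same image as that multiple of the cocycle, and q1 is
    injective in degree j. Generation: a multiple of a rational cocycle comes from a
    homogeneous integral cochain, which is a cocycle because q2 is injective. *)
Lemma tensorQ_piece : is_tensorQ iota.
Proof.
apply: tensorQ_intro => [x|v].
  have /asboolP[z zj zx] : coh_piece j (val x) := valP x.
  rewrite /= /rational_piece => /(congr1 vsval); rewrite vsprojK ?rational_class_sub //.
  rewrite -zx rational_classE raddf0 => /eqP; rewrite -memv_ker lker_phi.
  case/memv_imgP=> w _; rewrite lfunE => e.
  have [n [u [n0 uj wu]]] := q0_gen w; exists n => //.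
  have [p0 pB] := @piece_closed (cochain C i) j.
  have zn : val z *+ n = d0 u.
    apply/eqP; rewrite -subr_eq0; apply/eqP/q1_inj.
      apply: pB; last exact: piece_d0.
      exact: piece_mulrn.
    by rewrite raddfB raddfMn e q1d -wu linearMn subrr.
  have e0 : coh_class d0 d1 (z *+ n) = coh_class d0 d1 0.
    apply/coh_classP; rewrite subr0 unfold_in; apply/asboolP; exists u.
    by rewrite -zn raddfMn.
  apply: val_inj; transitivity (val x *+ n); first exact: raddfMn.
  by rewrite -zx -raddfMn e0 raddf0.
have := subvsP v; case/memv_imgP=> w wZ vw.
have [n [u [n0 uj wu]]] := q1_gen w.
have du : d1 u == 0.
  apply/eqP/q2_inj; first exact: piece_d1.
  by move: wZ; rewrite memv_ker lfunE q2d -wu linearMn => /eqP ->; rewrite mul0rn.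
pose z : cocycle d1 := exist _ u du.
have zP : coh_piece j (coh_class d0 d1 z) by apply/asboolP; exists z.
exists n, (exist _ (coh_class d0 d1 z) zP); split=> //.
apply: val_inj; rewrite /= /rational_piece /= vsprojK ?rational_class_sub //.
by rewrite rational_classE raddfMn /= vw -raddfMn wu.
Qed.

(** Rank-nullity for the restriction of phi to the cocycles. *)
Lemma dimQ_cohomology :
  (dimQ (homogeneous (cohomology C i) j) + \dim (limg (linfun f)))%N
  = \dim (lker (linfun g)).
Proof.
rewrite (dimQ_eq tensorQ_piece) dimvf.
have := limg_ker_dim phi Z; rewrite lker_phi (capv_idPr boundaries_sub_cycles).
by rewrite addnC.
Qed.

End CohomologyDimension.

(** * The cube in a fixed degree over the rationals *)

Section RationalCube.
Context (D : diagram) (le : rel {set dart D}).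
Local Notation pt := {set dart D}.
Implicit Types (s t : {set pt} * {set pt}) (i j k : int).

(** The exponent n such that c^n s has degree j, provided that there is one. *)
Definition c_exp j s : nat := `|j - gen_deg s|%N./2.

Definition reaches j s : bool := (c_exp j s)%:Z *+ 2 + gen_deg s == j.

Lemma c_expE j s n : n%:Z *+ 2 + gen_deg s = j -> c_exp j s = n.
Proof. by move=> e; rewrite /c_exp -e addrK mulr2n -PoszD addnn absz_nat doubleK. Qed.

Lemma reachesP j s : reflect (exists n, n%:Z *+ 2 + gen_deg s = j) (reaches j s).
Proof.
by apply: (iffP eqP) => [e|[n e]]; [exists (c_exp j s) | rewrite (c_expE e)].
Qed.

Definition basis i j := {s : generator D i | reaches j (val s)}.
Definition Qcube i j := {ffun basis i j -> rat^o}.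

(** The coordinates of the degree j component of v. *)
Definition to_Q i j (v : cube D i) : Qcube i j :=
  [ffun s => ((v (val s) : Rc)`_(c_exp j (val (val s))))%:~R].

Lemma to_QB i j : {morph @to_Q i j : u v / u - v}.
Proof. by move=> u v; apply/ffunP => s; rewrite !ffunE coefB rmorphB. Qed.
HB.instance Definition _ i j :=
  GRing.isZmodMorphism.Build (cube D i) (Qcube i j) (@to_Q i j) (@to_QB i j).

(** Entry of the differential between the monomials of degree j over s and t,
    with the sign (-1)^e of a shift of complexes. *)
Definition Q_coef e j s t : int :=
  (-1) ^+ e * (d_coef le s t)`_(c_exp j t - c_exp j s).

Definition Q_diff e i k j (w : Qcube i j) : Qcube k j :=
  [ffun t => \sum_s (Q_coef e j (val (val s)) (val (val t)))%:~R * (w s : rat)].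

Lemma Q_diff_linear e i k j : linear (@Q_diff e i k j).
Proof.
move=> a u v; apply/ffunP => t; rewrite !ffunE scaler_sumr -big_split /=.
apply: eq_bigr => s _; rewrite !ffunE /= mulrDr; congr (_ + _).
by rewrite /GRing.scale /= mulrCA.
Qed.
HB.instance Definition _ e i k j :=
  GRing.isLinear.Build rat (Qcube i j) (Qcube k j) _ (@Q_diff e i k j)
    (@Q_diff_linear e i k j).

(** Since d_coef is homogeneous, only one coefficient of it and one of p can
    contribute in degree j. *)
Lemma coef_d_coef_mul j s t (p : Rc) : reaches j t ->
  (d_coef le s t * p)`_(c_exp j t) =
  if reaches j s then (d_coef le s t)`_(c_exp j t - c_exp j s) * p`_(c_exp j s) else 0.
Proof.
move=> /eqP rt; rewrite coefM.
have deg m : (d_coef le s t)`_m != 0 -> (m <= c_exp j t)%N ->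
    reaches j s /\ c_exp j s = (c_exp j t - m)%N.
  move=> /d_coef_deg e mt.
  have e' : (c_exp j t - m)%N%:Z *+ 2 + gen_deg s = j.
    by rewrite -e -[RHS]rt -subzn // mulrnBl; ring.
  by split; [apply/reachesP; exists (c_exp j t - m)%N | apply: c_expE].
case: ifPn => rs; last first.
  rewrite big1 // => m _; apply/eqP; rewrite mulf_eq0; apply/orP; left.
  by apply: contraNT rs => /deg; case; rewrite // -ltnS.
have [st|ts] := leqP (c_exp j s) (c_exp j t).
  have mlt : (c_exp j t - c_exp j s < (c_exp j t).+1)%N by rewrite ltnS leq_subr.
  rewrite (bigD1 (Ordinal mlt)) //= subKn // big1 ?addr0 // => m mn.
  apply/eqP; rewrite mulf_eq0; apply/orP; left; apply: contraNT mn => nz.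
  have [|_ es] := deg _ nz; first by rewrite -ltnS.
  by apply/eqP/val_inj; rewrite /= es subKn // -ltnS.
have d0 : (d_coef le s t)`_(c_exp j t - c_exp j s) = 0.
  apply/eqP; apply: contraTT ts => nz.
  have [|_ ->] := deg _ nz; first exact: leq_subr.
  by rewrite -leqNgt leq_subr.
rewrite d0 mul0r big1 // => m _; apply/eqP; rewrite mulf_eq0; apply/orP; left.
apply: contraTT ts => nz; have [|_ ->] := deg _ nz; first by rewrite -ltnS.
by rewrite -leqNgt leq_subr.
Qed.

Lemma to_Q_diff e i k j (v : cube D i) :
  to_Q j ((-1) ^+ e *: cube_diff le k v) = Q_diff e k (to_Q j v).
Proof.
apply/ffunP => t; rewrite !ffunE.
have -> : (((-1) ^+ e : Rc) *: (\sum_s d_coef le (val s) (val (val t)) * (v s : Rc) : Rc^o) : Rc)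
     = (-1) ^+ e * \sum_s d_coef le (val s) (val (val t)) * (v s : Rc) by [].
have coef_sign (p : Rc) m : ((-1) ^+ e * p)`_m = (-1) ^+ e * p`_m.
  by rewrite -signr_odd -[in RHS]signr_odd; case: (odd e);
    rewrite ?expr0 ?expr1 ?mul1r ?mulN1r ?coefN.
rewrite coef_sign coef_sum mulr_sumr rmorph_sum /=.
transitivity (\sum_(s : generator D i | reaches j (val s))
   (Q_coef e j (val s) (val (val t)))%:~R * ((v s : Rc)`_(c_exp j (val s)))%:~R : rat).
  rewrite [RHS]big_mkcond; apply: eq_bigr => s _.
  rewrite (coef_d_coef_mul _ _ (valP t)); case: ifP => _; last by rewrite mulr0.
  by rewrite /Q_coef mulrA rmorphM.
rewrite -(sum_sig (fun s : generator D i => reaches j (val s)) (fun s : generator D i =>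
  (Q_coef e j (val s) (val (val t)))%:~R * ((v s : Rc)`_(c_exp j (val s)))%:~R : rat)).
by apply: eq_bigr => s _; rewrite ffunE.
Qed.

Lemma cube_piece_diff i k j (v : cube D i) : cube_piece j v ->
  cube_piece j (cube_diff le k v).
Proof.
move=> /asboolP vj; apply/asboolP => t n; rewrite ffunE coef_sum.
apply: contraNeq => ne; apply/eqP/big1 => s _; rewrite coefM big1 // => m _.
apply/eqP; apply: contraNT ne; rewrite mulf_eq0 negb_or => /andP[/d_coef_deg e /vj <-].
rewrite -e; apply/eqP.
have mn : (m <= n)%N by rewrite -ltnS.
by rewrite -subzn // mulrnBl; ring.
Qed.

Lemma to_Q_inj i j (v : cube D i) : cube_piece j v -> to_Q j v = 0 -> v = 0.
Proof.
move=> /asboolP vj v0; apply/ffunP => s; rewrite [RHS]ffunE; apply/polyP => n.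
rewrite coef0; apply/eqP; apply/negPn/negP => nz.
have e := vj _ _ nz.
have rs : reaches j (val s) by apply/reachesP; exists n.
have := congr1 (fun w : Qcube i j => w (exist _ s rs)) v0.
by rewrite !ffunE /= (c_expE e) => /eqP; rewrite intr_eq0 (negPf nz).
Qed.

Lemma to_Q_gen i j (w : Qcube i j) :
  exists n (v : cube D i), [/\ (0 < n)%N, cube_piece j v & w *+ n = to_Q j v].
Proof.
have [n n0 [z wz]] := common_denominator w.
pose v : cube D i := [ffun s => if insub s is Some s' then z s' *: 'X^(c_exp j (val s)) else 0].
exists n, v; split=> //.
  apply/asboolP => s m; rewrite ffunE; case: insubP => [s' rs es|]; last by rewrite coef0 eqxx.
  rewrite coefZ coefXn; have [->|] := eqVneq m; last by rewrite mulr0 eqxx.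
  by move=> _; apply/eqP.
apply/ffunP => s; rewrite ffunMnE wz !ffunE.
by rewrite valK coefZ coefXn eqxx mulr1.
Qed.

Lemma cube_diff_sq (plD : planar D) (leP : double_point_order le) i k l (v : cube D i) :
  i + 1 = k -> cube_diff le l (cube_diff le k v) = 0.
Proof.
move=> ik; apply/ffunP => u; rewrite !ffunE.
transitivity (\sum_(s : generator D i) (\sum_(t : generator D k)
   d_coef le (val s) (val t) * d_coef le (val t) (val u)) * (v s : Rc)).
  under eq_bigr => t _ do rewrite ffunE mulr_sumr.
  rewrite exchange_big; apply: eq_bigr => s _; rewrite mulr_suml.
  by apply: eq_bigr => t _; rewrite mulrA [d_coef _ _ (val u) * _]mulrC.
apply: big1 => s _; have /and3P[sD /eqP si sc] := valP s; have /and3P[_ _ uc] := valP u.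
by rewrite (d_coef_sq plD leP) ?mul0r // si.
Qed.

End RationalCube.

(** * The graded Euler characteristic *)

Lemma fsumE (F : int -> int) (r : seq int) : uniq r ->
  (forall i, i \notin r -> F i = 0) ->
  \sum_(i \in [set: int]%classic) F i = \sum_(i <- r) F i.
Proof.
move=> ur F0; rewrite (fsbigE r) //; last by move=> i _; apply: F0.
by apply: eq_bigl => i; rewrite classical_sets.in_setT.
Qed.

Lemma signz_natB (x k : nat) : (-1) ^ (k%:Z - x%:Z) = (-1) ^+ x * (-1) ^+ k :> int.
Proof.
rewrite exprzDr ?unitrN1 // mulrC; congr (_ * _); rewrite -exprnN -signr_odd.
by rewrite -[RHS]signr_odd; case: (odd x); rewrite ?expr1 ?expr0 ?invrN1 ?invr1.
Qed.

(** Each rank occurs in two consecutive degrees, with opposite signs. *)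
Lemma alternating_telescope (N r : nat -> int) n :
  \sum_(k < n) (-1) ^+ k * (N k - r k - r k.+1) =
  \sum_(k < n) (-1) ^+ k * N k - r 0%N + (-1) ^+ n * r n.
Proof.
elim: n => [|n IHn]; first by rewrite !big_ord0 expr0; ring.
by rewrite !big_ord_recr /= IHn exprS; ring.
Qed.

Lemma cube_piece_sign D i j e (v : cube D i) : cube_piece j v ->
  cube_piece j ((-1) ^+ e *: v).
Proof.
have [c0 cB] := @cube_piece_closed D i j => vj.
rewrite -signr_odd; case: (odd e); rewrite ?expr0 ?scale1r // expr1 scaleN1r -sub0r.
exact: cB.
Qed.

Section EulerCharacteristic.
Context (D : diagram) (plD : planar D) (o : pred (dart D)).
Context (le : rel {set dart D}) (leP : double_point_order le).
Local Notation x := (xcross o).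
Local Notation y := (ycross o).

Definition Q_rank j a b : nat := \dim (limg (linfun (@Q_diff D le x a b j))).
Definition Q_dim j a : nat := #|{: basis D a j}|.

Lemma dim_Qcube a j : dim (Qcube D a j) = Q_dim j a.
Proof. exact: muln1. Qed.

Lemma Q_rank_ker j a b : (\dim (lker (linfun (@Q_diff D le x a b j))) + Q_rank j a b
  = Q_dim j a)%N.
Proof. by rewrite -dim_Qcube -dimvf -(limg_ker_dim (linfun (@Q_diff D le x a b j)) fullv) capfv. Qed.

Lemma chi_hat_khovanov i j :
  chi_hat (khovanov le o i) j =
    (Q_dim (j + (x%:Z *+ 2 - y%:Z)) (i + x%:Z))%:Z
    - (Q_rank (j + (x%:Z *+ 2 - y%:Z)) (i - 1 + x%:Z) (i + x%:Z))%:Z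
    - (Q_rank (j + (x%:Z *+ 2 - y%:Z)) (i + x%:Z) (i + 1 + x%:Z))%:Z.
Proof.
set j' := j + _; rewrite /chi_hat /khovanov.
pose C := khovanov_complex le o.
pose q a : {additive cube D a -> Qcube D a j'} := @to_Q D a j'.
pose f a b : {linear Qcube D a j' -> Qcube D b j'} := @Q_diff D le x a b j'.
have key : (dimQ (homogeneous (cohomology C i) j) + Q_rank j' (i - 1 + x%:Z) (i + x%:Z))%N
    = \dim (lker (linfun (@Q_diff D le x (i + x%:Z) (i + 1 + x%:Z) j'))).
  apply: (@dimQ_cohomology C i j _ _ _ (q (i - 1 + x%:Z)) (q (i + x%:Z)) (q (i + 1 + x%:Z))
    (f _ _) (f _ _)).
  - by move=> u; apply: to_Q_diff.
  - by move=> u; apply: to_Q_diff.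
  - by move=> u uj; apply: cube_piece_sign; apply: cube_piece_diff.
  - by move=> u uj; apply: cube_piece_sign; apply: cube_piece_diff.
  - by move=> u; apply: to_Q_inj.
  - by move=> u; apply: to_Q_inj.
  - exact: to_Q_gen.
  - exact: to_Q_gen.
  move=> u; rewrite /= linearZ /= -/(cube_diff _ _ _).
  rewrite [cube_diff _ _ (cube_diff _ _ _)](cube_diff_sq plD leP) ?scaler0 //.
  by rewrite addrAC subrK.
have := Q_rank_ker j' (i + x%:Z) (i + 1 + x%:Z).
by rewrite -key => <-; rewrite !PoszD; ring.
Qed.

Lemma card_basis j a : Q_dim j a =
  #|[set s : {set {set dart D}} * {set {set dart D}} | [&& s.1 \subset double_points D,
       #|s.1|%:Z == a, s.2 \subset circles s.1 & reaches j s]]%SET|.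
Proof.
rewrite /Q_dim /basis card_sig -(card_image val_inj); apply: eq_card => s.
rewrite [RHS]inE; apply/imageP/and4P => [[g gr ->]|[sD sa sc sr]].
  by have /and3P[-> -> ->] := valP g.
by have sP : [&& s.1 \subset double_points D, #|s.1|%:Z == a & s.2 \subset circles s.1];
  [rewrite sD sa | exists (exist _ s sP)].
Qed.

Lemma Q_dim_out j a : (a < 0) || (#|double_points D|%:Z < a) -> Q_dim j a = 0%N.
Proof.
move=> out; rewrite card_basis; apply/eqP; rewrite cards_eq0; apply/eqP/setP => s.
rewrite !inE; apply/negP => /and4P[/subset_leq_card sD /eqP sa _ _].
by move: out; rewrite -sa => /orP[|]; rewrite ltNge ?lez_nat ?sD // le0z_nat.
Qed.

Lemma Q_rank_out j a b : Q_dim j a = 0%N \/ Q_dim j b = 0%N -> Q_rank j a b = 0%N.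
Proof.
case=> e; apply/eqP; rewrite -leqn0 -e.
  by rewrite -(Q_rank_ker j a b) leq_addl.
by rewrite -dim_Qcube -dimvf dimvS // subvf.
Qed.

Lemma alternating_chi_khovanov j :
  alternating_chi_hat (khovanov le o) j =
  (-1) ^+ x * \sum_(k < #|double_points D|.+1)
    (-1) ^+ k * (Q_dim (j + (x%:Z *+ 2 - y%:Z)) k%:Z)%:Z.
Proof.
set j' := j + _; set n := #|double_points D|.
(* The cochains in degree i are those of the cube in degree i + x, which vanish unless
   0 <= i + x <= n. *)
pose r := [seq k%:Z - x%:Z | k <- iota 0 n.+1].
have inj_r : injective (fun k : nat => k%:Z - x%:Z) by move=> a b /addIr[].
rewrite /alternating_chi_hat (@fsumE _ r); first last.
- move=> i ir; rewrite chi_hat_khovanov -/j'.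
  have out : (i + x%:Z < 0) || (n%:Z < i + x%:Z).
    apply: contraNT ir; rewrite negb_or -!leNgt => /andP[i0 iN].
    apply/mapP; exists (absz (i + x%:Z)); last by rewrite gez0_abs // addrK.
    by rewrite mem_iota add0n leq0n ltnS -lez_nat gez0_abs.
  have z := Q_dim_out j' out.
  by rewrite z !Q_rank_out ?subr0 ?mulr0 //; [left|right].
- by rewrite map_inj_uniq ?iota_uniq.
rewrite big_map -/(index_iota 0 n.+1) big_mkord mulr_sumr.
(* The rank of the differential arriving in degree k of the cube. *)
pose rk k := (Q_rank j' (k%:Z - 1) k%:Z)%:Z.
transitivity (\sum_(k < n.+1) (-1) ^+ x * ((-1) ^+ k * ((Q_dim j' k%:Z)%:Z - rk k - rk k.+1))).
  apply: eq_bigr => k _; rewrite signz_natB chi_hat_khovanov -/j' mulrA.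
  congr (_ * (_ - _ - _)); rewrite ?subrK // /rk.
    by rewrite addrAC subrK.
  by rewrite addrAC subrK !intS [1 + _]addrC addrK.
rewrite -!mulr_sumr; congr (_ * _).
rewrite (alternating_telescope (fun k => (Q_dim j' k%:Z)%:Z) rk n.+1).
rewrite /rk !Q_rank_out ?mulr0 ?addr0 ?subr0 //.
  by right; apply: Q_dim_out; rewrite ltz_nat ltnSn orbT.
by left; apply: Q_dim_out.
Qed.

(** Multiplication by c is a bijection from the monomials of degree j - 2 onto
    those of degree j other than the generators themselves. Hence the factor
    1 - q^2 reduces the count of monomials to that of generators. *)
Lemma reaches_step (s : {set {set dart D}} * {set {set dart D}}) j :
  (reaches j s : nat) = ((gen_deg s == j) + reaches (j - 2) s)%N.
Proof.
have rE n : (n.+1%:Z *+ 2 + gen_deg s = j) <-> (n%:Z *+ 2 + gen_deg s = j - 2).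
  by split=> [<-|e]; [rewrite intS | rewrite intS -[RHS](subrK 2) -e]; ring.
have [e|ne] := eqVneq (gen_deg s) j.
  have -> : reaches j s by apply/reachesP; exists 0%N; rewrite mul0rn add0r.
  case: (boolP (reaches (j - 2) s)) => // /reachesP[n].
  by rewrite -e mulr2n; move: (gen_deg s) => g; lia.
congr nat_of_bool; apply/reachesP/reachesP => [[[|n]]|[n]].
- by rewrite mul0rn add0r => /eqP; rewrite (negPf ne).
- by move/rE; exists n.
- by move/rE; exists n.+1.
Qed.

End EulerCharacteristic.

(** The bracket expanded over all states: L chooses the smoothings, and S chooses
    one of the two terms of q + q^-1 for each circle. *)
Definition state_sum D : laurent := fun j =>
  \sum_(L : {set {set dart D}} | L \subset double_points D)
    \sum_(S : {set {set dart D}} | S \subset circles L)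
      (-1) ^+ #|L| * (gen_deg (L, S) == j)%:R.

Lemma lmul_1_sub_q2 (F : laurent) j :
  lmul (qpow 0 \- qpow 2) F j = F j - F (j - 2).
Proof.
rewrite /lmul (@fsumE _ [:: 0; 2]) //= => [|i]; last first.
  by rewrite !inE negb_or /qpow => /andP[/negPf-> /negPf->]; rewrite subrr mul0r.
by rewrite big_cons big_seq1 /qpow /= !subr0 mul1r sub0r mulN1r.
Qed.

Lemma lmul_qpow (e : int) n (F : laurent) j :
  lmul (fun i => e * qpow n i) F j = e * F (j - n).
Proof.
rewrite /lmul (@fsumE _ [:: n]) //= => [|i]; last first.
  by rewrite !inE /qpow => /negPf->; rewrite mulr0 mul0r.
by rewrite big_seq1 /qpow eqxx mulr1.
Qed.

(** Up to the shifts of C(D), the right-hand side of the theorem counts the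
    generators of the cube with the sign of their cohomological degree. *)
Lemma euler_khovanov D (plD : planar D) (o : pred (dart D))
    (le : rel {set dart D}) (leP : double_point_order le) j :
  lmul (qpow 0 \- qpow 2) (alternating_chi_hat (khovanov le o)) j =
  (-1) ^+ xcross o * state_sum D (j + ((xcross o)%:Z *+ 2 - (ycross o)%:Z)).
Proof.
rewrite lmul_1_sub_q2 !alternating_chi_khovanov //.
set j' := j + _; rewrite -mulrBr; congr (_ * _); rewrite -sumrB.
pose P (s : {set {set dart D}} * {set {set dart D}}) :=
  (s.1 \subset double_points D) && (s.2 \subset circles s.1).
transitivity (\sum_(s | P s) (-1) ^+ #|s.1| * (gen_deg s == j')%:R : int); last first.
  by rewrite /state_sum pair_big_dep.
transitivity (\sum_(k < #|double_points D|.+1) \sum_(s | P s && (#|s.1| == k))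
  (-1) ^+ #|s.1| * (gen_deg s == j')%:R : int).
  apply: eq_bigr => k _; rewrite -mulrBr !card_basis.
  have cardE j0 : (#|[set s : {set {set dart D}} * {set {set dart D}} |
      [&& s.1 \subset double_points D, #|s.1|%:Z == k%:Z, s.2 \subset circles s.1
        & reaches j0 s]]%SET|%:Z = \sum_(s | P s && (#|s.1| == k)) (reaches j0 s : nat)%:Z).
    rewrite -sum1_card -natz natr_sum big_mkcond [RHS]big_mkcond; apply: eq_bigr => s _.
    rewrite inE /P eqz_nat; case: (_ \subset _); case: (_ \subset _); case: (_ == _) => //=.
    by case: reaches.
  rewrite !cardE -sumrB mulr_sumr; apply: eq_bigr => s /andP[_ /eqP <-].
  rewrite (reaches_step s j') PoszD.
  have -> : j - 2 + ((xcross o)%:Z *+ 2 - (ycross o)%:Z) = j' - 2 by rewrite /j'; ring.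
  by rewrite addrK; case: (_ == _).
rewrite (exchange_big_dep P) //=; last by move=> k s _ /andP[].
apply: eq_bigr => s Ps.
have sk : (#|s.1| < #|double_points D|.+1)%N.
  by rewrite ltnS subset_leq_card //; case/andP: Ps.
by rewrite (big_pred1 (Ordinal sk)) // => k; rewrite Ps /= eq_sym.
Qed.

(** * The state sum and the skein relation *)

Section Skein.
Context (D : diagram) (p : dart D) (pd : is_double p).
Local Notation a := (vertex p).
Implicit Types (L S : {set {set dart D}}).

(** The state of D that restricts to L on the b-resolution at p. *)
Definition mark (b : bool) L : {set {set dart D}} := if b then (a |: L)%SET else L.

Lemma smoothing_resolve b L (x : dart D) : a \notin L ->
  @smoothing (resolve p b) L x = @smoothing D (mark b L) x.
Proof.
move=> aL; rewrite {1}/smoothing /smooth /=.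
have [xp|xp] := boolP (x \in vertex p).
  have rx : res_rot p b x = smooth b x by rewrite /res_rot xp.
  have rrx : res_rot p b (smooth b x) = x by rewrite /res_rot vertex_smooth xp smoothK.
  rewrite !(rx, rrx) if_same /smoothing (vertex_eq xp); congr (smooth _ _).
  by rewrite /mark; case: b {rx rrx}; rewrite ?setU11 ?(negPf aL).
have rx n : iter n (res_rot p b) x = iter n rot x.
  elim: n => //= n ->; rewrite /res_rot ifN //.
  by elim: n => //= n; rewrite vertex_rot.
have := rx 1%N; have := rx 3%N => /= -> ->.
rewrite /smoothing /smooth.
suff -> : (vertex (x : dart (resolve p b)) \in L) = (vertex x \in mark b L) by [].
rewrite [vertex (x : dart (resolve p b))]vertex_resolve // /mark.
case: b {rx} => //; rewrite in_setU1.
by have [e|] := eqVneq (vertex x) a; rewrite // -e mem_vertex in xp.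
Qed.

Lemma circles_resolve b L : a \notin L ->
  @circles (resolve p b) L = @circles D (mark b L) :> {set {set dart D}}.
Proof.
move=> aL; rewrite /circles; apply: eq_imset => x; apply/setP => y; rewrite !inE.
by apply: eq_connect => u v /=; rewrite smoothing_resolve.
Qed.

Lemma gen_deg_resolve b L S : a \notin L ->
  gen_deg (mark b L, S) = @gen_deg (resolve p b) (L, S) + b%:Z.
Proof.
move=> aL; rewrite /gen_deg /= circles_resolve // -addrA; congr (_ + _).
by rewrite /mark; case: b; rewrite ?addr0 // cardsU1 aL PoszD addrC.
Qed.

(** States are sorted according to the smoothing at p; the 1-smoothing raises
    both the cohomological degree and the q-degree by one. *)
Lemma state_sum_skein j :
  state_sum D j = state_sum (resolve p false) j - state_sum (resolve p true) (j - 1).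
Proof.
have aD : a \in double_points D by rewrite mem_double_points.
have sub L : (L \subset (double_points D :\ a)%SET) = (L \subset double_points D) && (a \notin L).
  by rewrite subsetD1.
have resE b j0 : state_sum (resolve p b) j0 =
    \sum_(L : {set {set dart D}} | L \subset (double_points D :\ a)%SET)
    \sum_(S : {set {set dart D}} | S \subset circles (mark b L))
      (-1) ^+ #|L| * (gen_deg (mark b L, S) - b%:Z == j0)%:R.
  rewrite /state_sum double_points_resolve; apply: eq_bigr => L.
  rewrite sub => /andP[_ aL]; rewrite circles_resolve //; apply: eq_bigr => S _.
  by rewrite gen_deg_resolve // addrK.
rewrite !resE /state_sum (bigID (fun L : {set {set dart D}} => a \notin L)) /=; congr (_ + _).
  rewrite (eq_bigl _ _ sub); apply: eq_bigr => L _; apply: eq_bigr => S _.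
  by rewrite subr0.
rewrite (reindex_onto (fun L => a |: L)%SET (fun L => L :\ a)%SET) /=; last first.
  by move=> L /andP[_]; rewrite negbK => aL; rewrite setD1K.
rewrite -sumrN; apply: eq_big => [L|L /andP[/andP[LD _] /eqP LE]].
  rewrite sub subUset sub1set aD setU11 /= andbT; congr (_ && _).
  by apply/eqP/idP => [<-|aL]; [rewrite setD11 | rewrite setU1K].
have aL : a \notin L by rewrite -LE setD11.
rewrite -sumrN; apply: eq_bigr => S _.
by rewrite cardsU1 aL exprD expr1 !mulN1r mulNr subr_eq subrK.
Qed.

End Skein.

(** * Diagrams without double points *)

Section Restriction.
Context (D : diagram) (P : pred (dart D)).
Hypotheses (Parc : forall x, P (arc x) = P x) (Prot : forall x, P (rot x) = P x).
Let T : finType := {x | P x}.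

Definition restrict_arc (x : T) : T := exist _ (arc (val x)) (etrans (Parc (val x)) (valP x)).
Definition restrict_rot (x : T) : T := exist _ (rot (val x)) (etrans (Prot (val x)) (valP x)).

Lemma restrict_arcK : involutive restrict_arc.
Proof. by move=> x; apply: val_inj; rewrite /= arcK. Qed.
Lemma restrict_arc_neq x : restrict_arc x != x.
Proof. by rewrite -val_eqE /= arc_neq. Qed.
Lemma restrict_rot4 x : restrict_rot (restrict_rot (restrict_rot (restrict_rot x))) = x.
Proof. by apply: val_inj; rewrite /= rot4. Qed.
Lemma restrict_rot_neq x : restrict_rot x != x.
Proof. by rewrite -val_eqE /= rot_neq. Qed.
Lemma restrict_over_alt x : restrict_rot (restrict_rot x) != x ->
  over (val (restrict_rot x)) = ~~ over (val x).
Proof. by rewrite -val_eqE /=; apply: over_alt. Qed.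

Definition restriction : diagram :=
  Diagram restrict_arcK restrict_arc_neq restrict_rot4 restrict_rot_neq restrict_over_alt.

Lemma double_points_restriction :
  double_points D = finset.set0 -> double_points restriction = finset.set0.
Proof.
move=> D0; apply/setP => c; rewrite [RHS]inE; apply/imsetP => -[x].
rewrite inE => xd _; have : vertex (val x) \in double_points D.
  by rewrite mem_double_points; move: xd; rewrite /is_double -val_eqE.
by rewrite D0 inE.
Qed.

Definition components (E : diagram) := n_comp (step (arcp E) (rotp E)) (dart E).

Lemma components_restriction :
  components restriction = n_comp (step (arcp D) (rotp D)) P.
Proof.
have clP : closed (step (arcp D) (rotp D)) P.
  by move=> u v; rewrite /step /= !permE !unfold_in => /orP[]/eqP->; rewrite ?Parc ?Prot.
rewrite /components (@adjunction_n_comp _ _ (val : T -> dart D) _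
  (step (arcp restriction) (rotp restriction)) _ _ P).
- by apply: eq_n_comp_r => x; rewrite !inE; apply/esym/(valP x).
- exact: step_sym.
- exact: step_sym.
- exact: clP.
apply: strict_adjunction; [exact: step_sym | exact: clP | exact: val_inj | | ].
- by apply/fintype.subsetP => x Px; apply/codomP; exists (exist _ x Px).
by move=> x y _; rewrite /step /= !permE -!val_eqE.
Qed.

End Restriction.

Section Loops.

(** The coefficients of (q + 1/q)^n. *)
Fixpoint loops n : laurent :=
  if n is m.+1 then fun j => loops m (j - 1) + loops m (j + 1) else qpow 0.

Lemma lmul_loop_value F j : lmul loop_value F j = F (j - 1) + F (j + 1).
Proof.
rewrite /lmul (@fsumE _ [:: 1; -1]) //= => [|i]; last first.
  by rewrite !inE negb_or /loop_value /qpow /= => /andP[/negPf-> /negPf->]; rewrite addr0 mul0r.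
by rewrite big_cons big_seq1 /loop_value /qpow /= addr0 add0r !mul1r opprK.
Qed.

(** Expanding (q + 1/q)^n over the choices of a term in each factor. *)
Lemma loops_count (T : finType) (K : {set T}) j :
  \sum_(S : {set T} | S \subset K)
    ((\sum_(C in K) label_deg (C \in S) == j)%:R : int) = loops #|K| j.
Proof.
have [n] := ubnP #|K|; elim: n K j => // n IHn K j le_n.
have [->|/set0Pn[C CK]] := eqVneq K finset.set0.
  rewrite cards0 (big_pred1 finset.set0) => [|S]; last by rewrite subset0.
  by rewrite big_set0 /= /qpow eq_sym.
rewrite (cardsD1 C) CK /= -!IHn; try by move: le_n; rewrite (cardsD1 C) CK.
set K' := (K :\ C)%SET.
have CK' : C \notin K' by rewrite !inE eqxx.
have KE : K = (C |: K')%SET by rewrite setD1K.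
have sumE S : \sum_(B in K) label_deg (B \in S) =
    label_deg (C \in S) + \sum_(B in K') label_deg (B \in S).
  by rewrite KE big_setU1.
rewrite (bigID (fun S : {set T} => C \in S)) /= addrC; congr (_ + _).
  apply: eq_big => [S|S /andP[_ /negPf CS]]; first by rewrite subsetD1.
  by rewrite sumE CS /= [_ == j - 1]eq_sym subr_eq eq_sym [1 + _]addrC.
rewrite (reindex_onto (fun S => C |: S)%SET (fun S => S :\ C)%SET) /=; last first.
  by move=> S /andP[_ CS]; rewrite setD1K.
apply: eq_big => [S|S /andP[_ /eqP SE]].
  rewrite subsetD1 subUset sub1set CK setU11 andbT /=; congr (_ && _).
  by apply/eqP/idP => [<-|CS]; [rewrite setD11 | rewrite setU1K].
rewrite sumE setU11 /= [-1 + _]addrC subr_eq; congr (_ == _)%:R.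
apply: eq_bigr => B BK'; congr label_deg; rewrite in_setU1.
by have [e|] := eqVneq B C; rewrite // -e BK' in CK'.
Qed.

Lemma state_sum_loops D : double_points D = finset.set0 ->
  state_sum D = loops #|circles (D := D) finset.set0|.
Proof.
move=> D0; apply/funext => j; rewrite /state_sum D0.
rewrite (big_pred1 finset.set0) => [|L]; last by rewrite subset0.
rewrite -loops_count; apply: eq_bigr => S _.
by rewrite cards0 expr0 mul1r /gen_deg /= cards0 addr0.
Qed.

Lemma components_circles D : double_points D = finset.set0 ->
  #|circles (D := D) finset.set0| = components D.
Proof.
move=> D0; rewrite card_circles; apply: eq_n_comp; apply: eq_connect => u v.
rewrite /step /= !permE /smoothing inE /smooth.
have r2 w : rot (rot w) = w :> dart D by have := rotpK D0 w; rewrite !permE.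
by rewrite !r2 if_same.
Qed.

End Loops.

(** * The Kauffman bracket is the state sum *)

Section Bracket.
Context (br : diagram -> laurent) (hbr : kauffman_bracket br).

Lemma negb_neq b : ~~ b != b. Proof. by case: b. Qed.
Lemma negb4 b : ~~ ~~ ~~ ~~ b = b. Proof. by case: b. Qed.
Lemma negb_alt b : ~~ ~~ b != b -> pred0 (~~ b) = ~~ pred0 b. Proof. by case: b. Qed.

(** A circle with one auxiliary point. *)
Definition unknot : diagram := Diagram negbK negb_neq negb4 negb_neq negb_alt.

Lemma no_double D : (forall p : dart D, rot (rot p) = p) -> double_points D = finset.set0.
Proof.
move=> r2; apply/setP => c; rewrite [RHS]inE; apply/imsetP => -[p].
by rewrite inE /is_double r2 eqxx.
Qed.

Lemma no_double_union D1 D2 : double_points D1 = finset.set0 ->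
  double_points D2 = finset.set0 -> double_points (disjoint_union D1 D2) = finset.set0.
Proof.
move=> D10 D20; apply: no_double => -[p|p] /=; congr (_ _).
  by have := rotpK D10 p; rewrite !permE.
by have := rotpK D20 p; rewrite !permE.
Qed.

Lemma finite_support_bound (F : laurent) : laurent_polynomial F ->
  exists B : int, forall j, B < j -> F j = 0.
Proof.
move=> /finite_seqP[s sE]; exists (\sum_(i <- s) `|i|) => j Bj.
apply/eqP/negPn/negP => Fj; have /= js : [set` s]%classic j by rewrite -sE.
move: Bj; rewrite (big_rem j) //= ltNge ler_wpDr ?ler_norm //.
by apply: sumr_ge0 => i _; apply: normr_ge0.
Qed.

(** The coefficients of F - 1 satisfy h (j + 2) = - h j, so that a nonzero one
    would produce infinitely many. *)
Lemma loop_value_cancel (F : laurent) : laurent_polynomial F ->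
  lmul loop_value F = loop_value -> F = qpow 0.
Proof.
move=> /finite_support_bound[B FB] e.
pose h j : int := F j - qpow 0 j.
have h2 j : h (j + 2) = - h j.
  have := congr1 (fun G : laurent => G (j + 1)) e.
  rewrite lmul_loop_value addrK -addrA /h /loop_value /qpow /=.
  have -> : (j + 1 == 1) = (j == 0) by rewrite -subr_eq0 addrK.
  have -> : (j + 1 == -1) = (j + 2 == 0) by rewrite -subr_eq0 opprK -addrA.
  rewrite -[1 + 1]/(2 : int) => e1.
  by apply: (addrI (F j)); rewrite addrA e1; ring.
have hk k j : h (j + (k%:Z *+ 2)) = (-1) ^+ k * h j.
  elim: k => [|k IHk]; first by rewrite mul0rn addr0 mul1r.
  by rewrite intS mulrnDl addrCA addrC h2 IHk exprS mulN1r mulNr.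
apply/funext => j; apply/eqP; rewrite -subr_eq0 -/(h j).
(* k is large enough for j + 2 k to exceed B and to be positive. *)
pose k := (absz B + absz j + 1)%N; have := hk k j.
have big : B < j + k%:Z *+ 2 /\ 0 < j + k%:Z *+ 2 by rewrite /k mulr2n; lia.
rewrite {1}/h FB; last by case: big.
rewrite /qpow gt_eqF ?subr0; last by case: big.
by move/esym/eqP; rewrite mulf_eq0 signr_eq0.
Qed.

(** The axioms do not mention the empty diagram, but adding it to a circle
    changes nothing, and q + 1/q can be cancelled. *)
Lemma bracket_empty D : #|dart D| = 0%N -> br D = qpow 0.
Proof.
move=> D0; have noD (p : dart D) : False by have := fintype0 p D0.
have d0 : double_points D = finset.set0 by apply: no_double => p; case: (noD p).
have u0 : double_points unknot = finset.set0 by apply: no_double => b; rewrite /= negbK.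
have plD := planar_no_double_points d0.
have plU := planar_no_double_points u0.
have plDU : planar (disjoint_union unknot D).
  by apply: planar_no_double_points; apply: no_double_union.
have brU : br unknot = loop_value.
  apply: (bracket_loop hbr plU u0).
  rewrite (_ : circles _ = [set finset.setT]%SET) ?cards1 //.
  apply/setP => c; rewrite in_set1 circlesE; apply/imsetP/eqP => [[b _ ->]|->].
    apply/setP => b'; rewrite !inE; have [->|nb] := eqVneq b' b; first exact: connect0.
    by apply: connect1; rewrite /step /= permE /=; case: b b' nb => -[].
  exists true => //; apply/setP => b'; rewrite !inE.
  by apply/esym; case: b'; [apply: connect0 | apply: connect1; rewrite /step /= permE].
apply: loop_value_cancel; first exact: (bracket_poly hbr plD).
rewrite -brU -(bracket_union hbr plU plD); apply: (bracket_iso hbr plDU plU).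
exists (fun x : dart (disjoint_union unknot D) =>
  match x with inl b => b | inr p => False_rect _ (noD p) end).
split=> [|[b|p]|[b|p]|[b|p]] //; try by case: (noD p).
by exists inl => [[b|p]|b] //; case: (noD p).
Qed.

Lemma bracket_split D (P : pred (dart D)) (Parc : forall x, P (arc x) = P x)
    (Prot : forall x, P (rot x) = P x)
    (Carc : forall x, predC P (arc x) = predC P x) (Crot : forall x, predC P (rot x) = predC P x) :
  double_points D = finset.set0 ->
  br D = lmul (br (restriction Parc Prot)) (br (restriction Carc Crot)).
Proof.
move=> D0; have R0 := double_points_restriction Parc Prot D0.
have C0 := double_points_restriction Carc Crot D0.
have U0 := no_double_union R0 C0.
rewrite -(bracket_union hbr (planar_no_double_points R0) (planar_no_double_points C0)).
apply/esym/(bracket_iso hbr (planar_no_double_points U0) (planar_no_double_points D0)).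
exists (fun x : dart (disjoint_union (restriction Parc Prot) (restriction Carc Crot)) =>
  match x with inl u => val u | inr u => val u end).
split=> [|[]//|[]//|[]//].
apply: inj_card_bij => [[u|u] [v|v] /= e|].
- by congr inl; apply: val_inj.
- by have := valP v; rewrite /= -e [P _](valP u).
- by have := valP u; rewrite /= e [P _](valP v).
- by congr inr; apply: val_inj.
by rewrite card_sum !card_sig cardC.
Qed.

(** The circles are split off one at a time by the multiplicativity of the
    bracket. *)
Lemma bracket_loops D : double_points D = finset.set0 -> br D = loops (components D).
Proof.
move En : (components D) => n; elim: n D En => [|n IHn] D En D0.
  apply: bracket_empty; apply/eqP/negPn/negP; rewrite -lt0n => /card_gt0P[p _].
  move: En; rewrite -components_circles // => /eqP; rewrite cards_eq0 => /eqP c0.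
  by have := mem_circles finset.set0 p; rewrite c0 inE.
have [p _] : exists p, p \in roots (step (arcp D) (rotp D)).
  have : (0 < components D)%N by rewrite En.
  by rewrite /components => /card_gt0P[p]; rewrite !inE => /andP[pr _]; exists p.
pose P : pred (dart D) := connect (step (arcp D) (rotp D)) p.
have Pst x y : step (arcp D) (rotp D) x y -> P y = P x.
  move=> xy; apply/esym/(same_connect_r (@step_sym _ (arcp D) (rotp D))).
  exact: connect1.
have Parc x : P (arc x) = P x by apply: Pst; rewrite /step /= permE eqxx.
have Prot x : P (rot x) = P x by apply: Pst; rewrite /step /= !permE eqxx orbT.
have Carc x : predC P (arc x) = predC P x by rewrite /= Parc.
have Crot x : predC P (rot x) = predC P x by rewrite /= Prot.
have R0 := double_points_restriction Parc Prot D0.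
have C0 := double_points_restriction Carc Crot D0.
have compP : components (restriction Parc Prot) = 1%N.
  by rewrite components_restriction n_comp_connect //; apply: step_sym.
have compC : components (restriction Carc Crot) = n.
  rewrite components_restriction; move: En.
  by rewrite {1}/components (n_compC P) -(components_restriction Parc Prot) compP add1n => -[<-].
rewrite (bracket_split Parc Prot Carc Crot D0) (IHn _ compC C0).
have -> : br (restriction Parc Prot) = loop_value.
  by apply: (bracket_loop hbr (planar_no_double_points R0) R0); rewrite components_circles.
by apply/funext => j; rewrite lmul_loop_value.
Qed.

Lemma bracket_state_sum D : planar D -> br D = state_sum D.
Proof.
have [n] := ubnP #|double_points D|; elim: n D => // n IHn D le_n plD.
have [D0|] := eqVneq (double_points D) finset.set0.
  by rewrite bracket_loops // state_sum_loops // components_circles.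
case/set0Pn=> c /imsetP[p]; rewrite inE => pd _ {c}.
have lt b : (#|double_points (resolve p b)| < n)%N.
  by move: le_n; rewrite double_points_resolve (cardsD1 (vertex p)) mem_double_points pd.
rewrite (bracket_skein hbr plD pd) !IHn //; try exact: planar_resolve.
apply/funext => j; rewrite (state_sum_skein pd j) /=; congr (_ - _).
have -> : qpow 1 = (fun i => 1 * qpow 1 i) by apply/funext => i; rewrite mul1r.
by rewrite lmul_qpow mul1r.
Qed.

End Bracket.

Theorem proposition9 (br : diagram -> laurent) (hbr : kauffman_bracket br)
    (D : diagram) (hD : planar D)
    (o : pred (dart D)) (ho : orientation o)
    (le : rel {set dart D}) (hle : double_point_order le) :
  scaled_bracket br o
  = lmul (qpow 0 \- qpow 2) (alternating_chi_hat (khovanov le o)).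
Proof.
apply/funext => j; rewrite euler_khovanov // /scaled_bracket (bracket_state_sum hbr hD).
by rewrite lmul_qpow; congr (_ * state_sum _ _); ring.
Qed.
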